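(* There exist absolute (numerical) constants $c,C,p>0$ such that the following holds. Let $n\ge 2$, $K\ge1$ be integers, let $b$ be a positive divisor of $n$, let $f_1,\dots,f_n:\mathbb{R}^{d_x}\times\mathbb{R}^{d_y}\to\mathbb{R}$ and $f=\frac1n\sum_{i=1}^n f_i$. Suppose: (a) every $f_i$ is differentiable and $\nabla f_i$ is $L$-Lipschitz, where $L>0$; (b) there are $A,B\ge 0$ with $\frac1n\sum_{i=1}^n\|\nabla_j f_i(z)-\nabla_j f(z)\|^2\le A\|\nabla_j f(z)\|^2+B$ for all $z\in\mathbb{R}^{d_x}\times\mathbb{R}^{d_y}$ and $j\in\{1,2\}$; (c) $\Phi(x):=\max_{y'} f(x;y')$ is well-defined for every $x$, the set $\operatorname{argmax}_{y'}f(x;y')$ is non-empty and closed for every $x$, and $\Phi$ is bounded below; (d) there is $\mu_2>0$ with $\|\nabla_2 f(x;y)\|^2\ge 2\mu_2(\Phi(x)-f(x;y))$ for all $(x;y)$; (e) $\Phi^*:=\min_x\Phi(x)$ is well-defined and there is $\mu_1>0$ with $\|\nabla\Phi(x)\|^2\ge 2\mu_1(\Phi(x)-\Phi^* )$ for all $x$. Let $\kappa_1=L/\mu_1$, $\kappa_2=L/\mu_2$, $\lambda=4$, $r\ge14\kappa_2^2$, $\alpha=\beta/r$, and $$\Lambda=\frac{V_\lambda(z_0^1)\,\mu_1nK^2}{8c^3\kappa_1^2r^3\left(\frac{n-b}{n-1}\right)B},\qquad \beta=b\cdot\min\left\{\frac{1}{6Ln\sqrt{1+\frac{n-b}{n-1}\cdot\frac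 An}},\ \frac{2r}{\mu_1nK}\max\{1,\log\Lambda\}\right\}.$$ Then both mini-batch simSGDA-RR and mini-batch altSGDA-RR with mini-batch size $b$, step sizes $\alpha,\beta$, and initial point $z_0^1$ satisfy $$\mathbb{E}[V_\lambda(z_0^{K+1})]\le C\,V_\lambda(z_0^1)\exp\left(-\frac{K}{12\kappa_1r\sqrt{1+\frac{n-b}{n-1}\cdot\frac An}}\right)+C\,\frac{\kappa_1^2r^3B}{\mu_1nK^2}\bigl(\max\{1,\log\Lambda\}\bigr)^p\cdot\frac{n-b}{n-1}.$$
   Context: Notation: $z=(x;y)$; $\nabla_1,\nabla_2$ are the gradients with respect to $x$ and $y$; $\|\cdot\|$ is the Euclidean norm. Under (a), (c), (d) the function $\Phi$ is differentiable. The potential function is $V_\lambda(x;y)=\lambda(\Phi(x)-\Phi^* )+(\Phi(x)-f(x;y))$. Algorithm (mini-batch SGDA with random reshuffling, $q=n/b$): the initial point $(x_0^1;y_0^1)$ is given. In each epoch $k=1,\dots,K$, a permutation $\sigma_k$ of $\{1,\dots,n\}$ is sampled uniformly at random (independently over epochs). For $t=1,\dots,q$, let $\mathcal{B}_t^k=\{\sigma_k(j):b(t-1)<j\le bt\}$ and update $x_t^k=x_{t-1}^k-\frac{\alpha}{b}\sum_{i\in\mathcal{B}_t^k}\nabla_1f_i(x_{t-1}^k;y_{t-1}^k)$ and $y_t^k=y_{t-1}^k+\frac{\beta}{b}\sum_{i\in\mathcal{B}_t^k}\nabla_2f_i(x';y_{t-1}^k)$, with $x'=x_{t-1}^k$ for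 simSGDA-RR and $x'=x_t^k$ for altSGDA-RR. Then $(x_0^{k+1};y_0^{k+1})=(x_q^k;y_q^k)$. $\mathbb{E}$ is over the permutations. Conventions: if $(n-b)B=0$, then the second argument of the minimum defining $\beta$ is $+\infty$ and the second term of the bound is $0$; $\log0=-\infty$.
   Formalization: Two hypotheses are added, since the claim fails for arbitrarily large vacuous PL constants: if f does not depend on y (f = Φ everywhere), then μ₂ ≤ L is assumed; if Φ is constant (Φ = Φ* everywhere), then μ₁ ≤ L is assumed. *)

(* Defs.v *)
From HB Require Import structures.
From mathcomp Require Export all_boot all_order all_algebra all_fingroup.
From mathcomp Require Export all_classical all_reals all_analysis.
Export Order.TTheory GRing.Theory Num.Theory.
Export numFieldNormedType.Exports.

Set Implicit Arguments.
Unset Strict Implicit.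
Unset Printing Implicit Defensive.

Local Open Scope classical_set_scope.
Local Open Scope ring_scope.

(* The norm that the library puts on 'rV[R]_d is the sup norm, hence an explicit
   Euclidean norm. Topological notions (differentiable, closed) are unaffected
   by this choice, all norms on R^d being equivalent. *)
Definition enorm (R : realType) (d : nat) (v : 'rV[R]_d) : R :=
  Num.sqrt (\sum_(i < d) v 0 i ^+ 2).

Definition grad (R : realType) (d : nat) (g : 'rV[R]_d -> R) (x : 'rV[R]_d) :
  'rV[R]_d := \row_(i < d) 'D_(delta_mx 0 i) g x.

Definition smooth (R : realType) (d : nat) (L : R) (g : 'rV[R]_d -> R) : Prop :=
  (forall z, differentiable g z) /\
  (forall z w, enorm (grad g z - grad g w) <= L * enorm (z - w)).

(* A point (x; y) of R^dx * R^dy is the concatenated vector row_mx x y of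
   R^(dx + dy), so that its Euclidean norm is the usual one. *)
Section Minimax.
Context (R : realType) (dx dy : nat).
Implicit Types (g : 'rV[R]_(dx + dy) -> R) (x : 'rV[R]_dx) (y : 'rV[R]_dy).

Definition grad1 g x y : 'rV[R]_dx := grad (fun x' => g (row_mx x' y)) x.

Definition grad2 g x y : 'rV[R]_dy := grad (fun y' => g (row_mx x y')) y.

Definition argmax g x : set 'rV[R]_dy :=
  [set y | forall y', g (row_mx x y') <= g (row_mx x y)].

(* sup and inf are the max and the min as soon as these are attained. *)
Definition primal g x : R := sup (range (fun y => g (row_mx x y))).

Definition primal_min g : R := inf (range (primal g)).

Definition potential (lambda : R) g (z : 'rV[R]_dx * 'rV[R]_dy) : R :=
  lambda * (primal g z.1 - primal_min g) + (primal g z.1 - g (row_mx z.1 z.2)).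

Definition average (n : nat) (fs : 'I_n -> 'rV[R]_(dx + dy) -> R) :
  'rV[R]_(dx + dy) -> R := fun z => n%:R^-1 * \sum_(i < n) fs i z.

End Minimax.

Inductive sgda_variant := SimSGDA | AltSGDA.

(* Indices are 0-based: the permutation acts on {0, ..., n-1} and the
   mini-batches of an epoch are numbered t = 0, ..., n / b - 1. *)
Definition minibatch (n b : nat) (s : 'S_n) (t : nat) : {set 'I_n} :=
  [set s j | j : 'I_n & (b * t <= j < b * t.+1)%N].

Section Algorithm.
Context (R : realType) (dx dy n : nat).
Variables (v : sgda_variant) (fs : 'I_n -> 'rV[R]_(dx + dy) -> R) (b : nat).
Variables (alpha beta : R).

Definition sgda_step (s : 'S_n) (z : 'rV[R]_dx * 'rV[R]_dy) (t : nat) :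
    'rV[R]_dx * 'rV[R]_dy :=
  let: (x, y) := z in
  let xnew := x - (alpha / b%:R) *:
    \sum_(i in minibatch b s t) grad1 (fs i) x y in
  let xgrad := if v is SimSGDA then x else xnew in
  let ynew := y + (beta / b%:R) *:
    \sum_(i in minibatch b s t) grad2 (fs i) xgrad y in
  (xnew, ynew).

Definition sgda_epoch (z : 'rV[R]_dx * 'rV[R]_dy) (s : 'S_n) :
    'rV[R]_dx * 'rV[R]_dy :=
  foldl (sgda_step s) z (iota 0 (n %/ b)).

Definition sgda_rr (z0 : 'rV[R]_dx * 'rV[R]_dy) (K : nat)
    (ss : K.-tuple 'S_n) : 'rV[R]_dx * 'rV[R]_dy :=
  foldl sgda_epoch z0 ss.

End Algorithm.

(* K independent uniform permutations are jointly uniform on K-tuples of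
   permutations, so the expectation is a finite average. *)
Definition expect_perms (R : realType) (n K : nat) (F : K.-tuple 'S_n -> R) : R :=
  (\sum_(ss : K.-tuple 'S_n) F ss) / #|{: K.-tuple 'S_n}|%:R.

(* Main.v *)
Require Import Defs.
From mathcomp Require Import ring lra.

(** Write [Phi] for the primal function, [f] for the average, and measure time in
    epochs: an epoch moves [y] by about [eta = beta n / b] times the gradient of
    [f] in [y], and [x] by about [eta / r] times minus the gradient in [x].

    Smoothness and the PL inequality in [y] squeeze [Phi] between two quadratics
    ([primal_upper_argmax], [primal_lower_argmax]); so its gradient is the partial
    gradient of [f] at a maximizer, it obeys a descent inequality with constant
    [L (1 + kappa2)], and its distance to the partial gradient of [f] at any other
    [y] is controlled by the gap [Phi - f] ([grad_gap_le]), hence by the gradient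
    in [y].

    If all gradients of an epoch were evaluated at its starting point, reshuffling
    would produce exactly a full-gradient step, since every component is used once.
    The true displacement differs from it only because the evaluation points drift
    ([epoch_displacements]). The drift consists of the full-gradient motion and of
    the error of sampling without replacement, whose variance carries the factor
    [(n - b) / (n - 1)] ([sampling_variance], [mean_sampling_error_sqr]).

    For exact steps of small length the potential decreases by multiples of the
    squared gradients of [Phi] and of [f] in [y] ([potential_descent]). As [x] is
    slower than [y] by a factor [r >= 14 kappa2 ^ 2], the difference between the
    two gradients in [x], and the part of the drift that is proportional to the
    gradients, are absorbed by this decrease ([descent_budget]). With the two PL
    inequalities, what is left contracts the expected potential by
    [1 - eta mu1 / (2 r)] per epoch, up to a noise of order
    [eta (L eta) ^ 2 rho B / n] ([epoch_descent]), where [rho] stands for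
    [(n - b) / (n - 1)].

    Over [K] epochs this gives the factor [exp (- K eta mu1 / (2 r))] on the initial
    potential and a noise floor of order [r (L eta) ^ 2 rho B / (n mu1)]. If
    [eta = 1 / (6 L S)], the former is the claimed exponential; if
    [eta = 2 r M / (mu1 K)], it is [exp (- M) <= 1 / Lambda], which brings the
    initial potential down to the noise floor. In both cases
    [eta <= 2 r M / (mu1 K)] bounds the noise floor when there is noise at all. *)

Set Implicit Arguments.
Unset Strict Implicit.
Unset Printing Implicit Defensive.

Local Open Scope classical_set_scope.
Local Open Scope ring_scope.

(** * The Euclidean inner product *)

Section Euclidean.
Context (R : realType).

Definition dotv d (u v : 'rV[R]_d) : R := \sum_(i < d) u 0 i * v 0 i.

Section Dim.
Context (d : nat).
Implicit Types (u v w : 'rV[R]_d) (a : R).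

Lemma dotvC u v : dotv u v = dotv v u.
Proof. by apply: eq_bigr => i _; rewrite mulrC. Qed.

Lemma dotvDl u v w : dotv (u + v) w = dotv u w + dotv v w.
Proof. by rewrite -big_split; apply: eq_bigr => i _; rewrite mxE mulrDl. Qed.

Lemma dotvDr u v w : dotv w (u + v) = dotv w u + dotv w v.
Proof. by rewrite dotvC dotvDl !(dotvC w). Qed.

Lemma dotvZl a u v : dotv (a *: u) v = a * dotv u v.
Proof. by rewrite mulr_sumr; apply: eq_bigr => i _; rewrite mxE mulrA. Qed.

Lemma dotvZr a u v : dotv u (a *: v) = a * dotv u v.
Proof. by rewrite dotvC dotvZl dotvC. Qed.

Lemma dotvNl u v : dotv (- u) v = - dotv u v.
Proof. by rewrite -scaleN1r dotvZl mulN1r. Qed.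

Lemma dotvNr u v : dotv u (- v) = - dotv u v.
Proof. by rewrite dotvC dotvNl dotvC. Qed.

Lemma dotv0l u : dotv 0 u = 0.
Proof. by rewrite -(scale0r 0) dotvZl mul0r. Qed.

Lemma dotv0r u : dotv u 0 = 0.
Proof. by rewrite dotvC dotv0l. Qed.

Definition dotvE := (dotvDl, dotvDr, dotvNl, dotvNr, dotvZl, dotvZr).

Lemma dotvv_ge0 u : 0 <= dotv u u.
Proof. by apply: sumr_ge0 => i _; rewrite -expr2 sqr_ge0. Qed.

Lemma enorm_ge0 u : 0 <= enorm u.
Proof. exact: sqrtr_ge0. Qed.

Lemma enorm_sqr u : enorm u ^+ 2 = dotv u u.
Proof.
rewrite /enorm sqr_sqrtr; last by apply: sumr_ge0 => i _; rewrite sqr_ge0.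
by apply: eq_bigr => i _; rewrite expr2.
Qed.

Lemma enorm_sum_sqr u : enorm u ^+ 2 = \sum_(i < d) u 0 i ^+ 2.
Proof. by rewrite enorm_sqr; apply: eq_bigr => i _; rewrite expr2. Qed.

Lemma enorm0 : enorm (0 : 'rV[R]_d) = 0.
Proof. by rewrite /enorm big1 ?sqrtr0// => i _; rewrite mxE expr0n. Qed.

Lemma enormZ a u : enorm (a *: u) = `|a| * enorm u.
Proof.
rewrite /enorm; under eq_bigr do rewrite mxE exprMn.
by rewrite -mulr_sumr sqrtrM ?sqr_ge0// sqrtr_sqr.
Qed.

Lemma enormN u : enorm (- u) = enorm u.
Proof. by rewrite -scaleN1r enormZ normrN normr1 mul1r. Qed.

Lemma enorm_distC u v : enorm (u - v) = enorm (v - u).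
Proof. by rewrite -enormN opprB. Qed.

Lemma enorm_eq0 u : enorm u = 0 -> u = 0.
Proof.
move/eqP; rewrite -sqrf_eq0 enorm_sum_sqr psumr_eq0; last first.
  by move=> i _; rewrite sqr_ge0.
move=> /allP u0; apply/rowP => i; rewrite mxE.
by have /= := u0 i (mem_index_enum _); rewrite sqrf_eq0 => /eqP.
Qed.

Lemma cauchy_schwarz u v : dotv u v <= enorm u * enorm v.
Proof.
have [/enorm_eq0 ->|u0] := eqVneq (enorm u) 0.
  by rewrite enorm0 mul0r dotv0l.
have [/enorm_eq0 ->|v0] := eqVneq (enorm v) 0.
  by rewrite enorm0 mulr0 dotv0r.
have up : 0 < enorm u by rewrite lt_neqAle eq_sym u0 enorm_ge0.
have vp : 0 < enorm v by rewrite lt_neqAle eq_sym v0 enorm_ge0.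
rewrite -subr_ge0 -(pmulr_rge0 _ vp) -(pmulr_rge0 _ up).
have := dotvv_ge0 (enorm v *: u - enorm u *: v).
rewrite !dotvE (dotvC v u) -!enorm_sqr; nra.
Qed.

Lemma enormD u v : enorm (u + v) <= enorm u + enorm v.
Proof.
rewrite -(@ler_pXn2r _ 2) ?nnegrE ?addr_ge0 ?enorm_ge0//.
rewrite sqrrD !enorm_sqr !dotvE (dotvC v u).
have := cauchy_schwarz u v; lra.
Qed.

Lemma enorm_sum (I : Type) (s : seq I) (P : pred I) (F : I -> 'rV[R]_d) :
  enorm (\sum_(i <- s | P i) F i) <= \sum_(i <- s | P i) enorm (F i).
Proof.
apply: (big_ind2 (fun u a => enorm u <= a)) => //; first by rewrite enorm0.
by move=> u a v b ua vb; apply: le_trans (enormD _ _) (lerD ua vb).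
Qed.

Lemma enorm_sqrD u v : enorm (u + v) ^+ 2 <= 2 * (enorm u ^+ 2 + enorm v ^+ 2).
Proof.
rewrite !enorm_sqr; have := dotvv_ge0 (u - v).
rewrite !dotvE (dotvC v u); lra.
Qed.

End Dim.

Lemma dotv_row_mx m n (a c : 'rV[R]_m) (b d : 'rV[R]_n) :
  dotv (row_mx a b) (row_mx c d) = dotv a c + dotv b d.
Proof.
rewrite /dotv big_split_ord /=; congr (_ + _); apply: eq_bigr => i _.
  by rewrite !row_mxEl.
by rewrite !row_mxEr.
Qed.

Lemma enorm_row_mx_sqr m n (a : 'rV[R]_m) (b : 'rV[R]_n) :
  enorm (row_mx a b) ^+ 2 = enorm a ^+ 2 + enorm b ^+ 2.
Proof. by rewrite !enorm_sqr dotv_row_mx. Qed.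

Lemma enorm_row_mx_le m n (a : 'rV[R]_m) (b : 'rV[R]_n) :
  enorm (row_mx a b) <= enorm a + enorm b.
Proof.
rewrite -(@ler_pXn2r _ 2) ?nnegrE ?addr_ge0 ?enorm_ge0//.
rewrite enorm_row_mx_sqr sqrrD.
have := mulr_ge0 (enorm_ge0 a) (enorm_ge0 b); lra.
Qed.

Lemma enorm_lsub_le m n (a : 'rV[R]_(m + n)) : enorm (lsubmx a) <= enorm a.
Proof.
rewrite -(@ler_pXn2r _ 2) ?nnegrE ?enorm_ge0// -{2}(hsubmxK a).
by rewrite enorm_row_mx_sqr lerDl sqr_ge0.
Qed.

Lemma enorm_rsub_le m n (a : 'rV[R]_(m + n)) : enorm (rsubmx a) <= enorm a.
Proof.
rewrite -(@ler_pXn2r _ 2) ?nnegrE ?enorm_ge0// -{2}(hsubmxK a).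
by rewrite enorm_row_mx_sqr lerDr sqr_ge0.
Qed.

End Euclidean.

(** * Gradients of smooth functions *)

Section Gradient.
Context (R : realType).

Section Dim.
Context (d : nat).
Implicit Types (g : 'rV[R]_d -> R) (x z h : 'rV[R]_d).

Lemma derive_grad g z h : differentiable g z -> 'D_h g z = dotv (grad g z) h.
Proof.
move=> dg; rewrite deriveE// [in LHS](row_sum_delta h) linear_sum.
by apply: eq_bigr => i _; rewrite linearZ mxE deriveE// mulrC.
Qed.

Lemma is_derive_line g z h (t : R) : (forall x, differentiable g x) ->
  is_derive t 1 (fun s : R => g (z + s *: h)) (dotv (grad g (z + t *: h)) h).
Proof.
move=> dg; have dd := dg (z + t *: h).
have E : (fun k : R => k^-1 *: (((fun s : R => g (z + s *: h)) \o shift t) (k *: 1)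
    - g (z + t *: h))) =
    (fun k : R => k^-1 *: ((g \o shift (z + t *: h)) (k *: h) - g (z + t *: h))).
  apply/funext => k /=; congr (_ *: (g _ - _)).
  by rewrite scalerDl [_ *: 1]mulr1 addrCA.
apply: DeriveDef.
  by rewrite /derivable E; exact: (diff_derivable dd).
by rewrite /derive E -derive_grad.
Qed.

Lemma smoothN L g : smooth L g -> smooth L (- g).
Proof.
move=> [dg Lg].
have gN z : grad (- g) z = - grad g z.
  apply/rowP => i; rewrite !mxE deriveN//.
  exact: diff_derivable (dg z).
by split=> [z|z w]; [exact: differentiableN|rewrite !gN -opprD enormN].
Qed.

(** The descent lemma: along the segment from [z] to [z + h], the function minus
    its claimed upper model has a nonpositive derivative. *)
Lemma smooth_upper L g z h : smooth L g ->
  g (z + h) <= g z + dotv (grad g z) h + L / 2 * enorm h ^+ 2.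
Proof.
move=> [dg Lg].
pose c := L / 2 * enorm h ^+ 2.
pose psi : R -> R := (fun s : R => g (z + s *: h)) -
  (dotv (grad g z) h \*: (id : R -> R)) - (c \*: ((id : R -> R) * id)).
pose dpsi (t : R) := dotv (grad g (z + t *: h)) h - dotv (grad g z) h *: (1 : R)
  - c *: (t *: (1 : R) + t *: 1).
have dpsiP (t : R) : is_derive t 1 psi (dpsi t).
  have dl := is_derive_line z h t dg.
  by rewrite /psi; apply: is_derive_eq.
have psic : {within `[0, 1], continuous psi}.
  apply: continuous_subspaceT => t.
  apply: differentiable_continuous; apply/derivable1_diffP.
  by have [] := dpsiP t.
have [t] := MVT ltr01 (fun t _ => dpsiP t) psic.
rewrite in_itv/= => /andP[t0 t1]; rewrite subr0 mulr1.
have -> : psi 1 = g (z + h) - dotv (grad g z) h - c.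
  rewrite /psi -![(_ - _ : _ -> _) _]/(_ - _) /= scale1r.
  have sm (a b : R) : a *: b = a * b by [].
  by rewrite -[(_ * _ : _ -> _) _]/(_ * _) !(sm, mulr1).
have -> : psi 0 = g z.
  rewrite /psi -![(_ - _ : _ -> _) _]/(_ - _) /= scale0r addr0.
  by rewrite -[(_ * _ : _ -> _) _]/(_ * _) mulr0 !scaler0 !subr0.
have : dpsi t <= 0.
  have sm (a b : R) : a *: b = a * b by [].
  rewrite /dpsi !(sm, mulr1).
  have -> : dotv (grad g (z + t *: h)) h - dotv (grad g z) h =
    dotv (grad g (z + t *: h) - grad g z) h by rewrite dotvDl dotvNl.
  have := cauchy_schwarz (grad g (z + t *: h) - grad g z) h.
  have := ler_wpM2r (enorm_ge0 h) (Lg (z + t *: h) z).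
  have -> : z + t *: h - z = t *: h by rewrite addrAC subrr add0r.
  rewrite enormZ (ger0_norm (ltW t0)) /c; lra.
by rewrite /c => ? ?; lra.
Qed.

Lemma smooth_lower L g z h : smooth L g ->
  g z + dotv (grad g z) h - L / 2 * enorm h ^+ 2 <= g (z + h).
Proof.
move=> sg; have := smooth_upper z h (smoothN sg).
have -> : grad (- g) z = - grad g z.
  apply/rowP => i; rewrite !mxE deriveN//; exact: diff_derivable (sg.1 z).
rewrite dotvNl -![(- _ : _ -> _) _]/(- _); lra.
Qed.

(** The error is of second order along each axis, so that [G] collects the partial
    derivatives at [x]. *)
Lemma grad_of_quadratic_bound g x (G : 'rV[R]_d) (c : R) :
  (forall h, `|g (x + h) - g x - dotv G h| <= c * enorm h ^+ 2) ->
  grad g x = G.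
Proof.
move=> gb; apply/rowP => i; rewrite mxE /derive.
have e1 : enorm (delta_mx 0 i : 'rV[R]_d) ^+ 2 = 1.
  rewrite enorm_sum_sqr (bigD1 i)//= mxE !eqxx expr1n big1 ?addr0// => j ji.
  by rewrite mxE (negbTE ji) andbF expr0n.
have dG : dotv G (delta_mx 0 i) = G 0 i.
  rewrite /dotv (bigD1 i)//= mxE !eqxx mulr1 big1 ?addr0// => j ji.
  by rewrite mxE (negbTE ji) andbF mulr0.
apply: cvg_lim => //; apply/cvgrPdist_le => e e0.
have c0 : 0 <= c.
  have := gb (delta_mx 0 i); rewrite e1 mulr1; exact: le_trans.
near=> k.
have k0 : k != 0 by near: k; exact: nbhs_dnbhs_neq.
rewrite /= (addrC _ x) -[_ *: (_ - _)]/(_ * _).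
have -> : G 0 i - k^-1 * (g (x + k *: delta_mx 0 i) - g x) =
    - (k^-1 * (g (x + k *: delta_mx 0 i) - g x - dotv G (k *: delta_mx 0 i))).
  by rewrite dotvZr dG; field.
rewrite normrN normrM; apply: le_trans (_ : `|k^-1| * (c * `|k| ^+ 2) <= _).
  rewrite ler_wpM2l//; apply: le_trans (gb _) _.
  by rewrite enormZ exprMn e1 mulr1.
have -> : `|k^-1| * (c * `|k| ^+ 2) = c * `|k|.
  by rewrite normfV; field; rewrite normr_eq0.
have kn : `|k| <= e / (c + 1).
  near: k; apply: dnbhs0_le; apply: divr_gt0 => //; lra.
apply: le_trans (ler_wpM2l c0 kn) _.
rewrite mulrA ler_pdivrMr; last lra.
nra.
Unshelve. all: by end_near. Qed.

End Dim.

Section Blocks.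
Context (dx dy : nat).
Implicit Types (g : 'rV[R]_(dx + dy) -> R) (x : 'rV[R]_dx) (y : 'rV[R]_dy).

Lemma grad1E g x y : grad1 g x y = lsubmx (grad g (row_mx x y)).
Proof.
apply/rowP => i; rewrite !mxE delta_mx_lshift /derive.
have E (v : 'rV_dx) :
    (fun k : R => k^-1 *: (((fun x' => g (row_mx x' y)) \o shift x) (k *: v)
      - g (row_mx x y))) =
    (fun k : R => k^-1 *: ((g \o shift (row_mx x y)) (k *: row_mx v 0)
      - g (row_mx x y))).
  apply/funext => k /=; congr (_ *: (g _ - _)).
  by rewrite scale_row_mx add_row_mx scaler0 add0r.
by rewrite E.
Qed.

Lemma grad2E g x y : grad2 g x y = rsubmx (grad g (row_mx x y)).
Proof.
apply/rowP => i; rewrite !mxE delta_mx_rshift /derive.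
have E (v : 'rV_dy) :
    (fun k : R => k^-1 *: (((fun y' => g (row_mx x y')) \o shift y) (k *: v)
      - g (row_mx x y))) =
    (fun k : R => k^-1 *: ((g \o shift (row_mx x y)) (k *: row_mx 0 v)
      - g (row_mx x y))).
  apply/funext => k /=; congr (_ *: (g _ - _)).
  by rewrite scale_row_mx add_row_mx scaler0 add0r.
by rewrite E.
Qed.

Lemma grad_row_mx g x y :
  grad g (row_mx x y) = row_mx (grad1 g x y) (grad2 g x y).
Proof. by rewrite grad1E grad2E hsubmxK. Qed.

Lemma smooth_upper2 L g x y h k : smooth L g ->
  g (row_mx (x + h) (y + k)) <= g (row_mx x y) + dotv (grad1 g x y) h
    + dotv (grad2 g x y) k + L / 2 * (enorm h ^+ 2 + enorm k ^+ 2).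
Proof.
move=> /(smooth_upper (row_mx x y) (row_mx h k)).
by rewrite add_row_mx grad_row_mx dotv_row_mx enorm_row_mx_sqr !addrA.
Qed.

Lemma smooth_lower2 L g x y h k : smooth L g ->
  g (row_mx x y) + dotv (grad1 g x y) h + dotv (grad2 g x y) k
    - L / 2 * (enorm h ^+ 2 + enorm k ^+ 2) <= g (row_mx (x + h) (y + k)).
Proof.
move=> /(smooth_lower (row_mx x y) (row_mx h k)).
by rewrite add_row_mx grad_row_mx dotv_row_mx enorm_row_mx_sqr !addrA.
Qed.

Lemma grad1_lip L g x y x' y' : 0 <= L -> smooth L g ->
  enorm (grad1 g x y - grad1 g x' y') <= L * (enorm (x - x') + enorm (y - y')).
Proof.
move=> L0 [_ Lg]; rewrite !grad1E -raddfB.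
apply: le_trans (enorm_lsub_le _) _; apply: le_trans (Lg _ _) _.
by rewrite opp_row_mx add_row_mx ler_wpM2l// enorm_row_mx_le.
Qed.

Lemma grad2_lip L g x y x' y' : 0 <= L -> smooth L g ->
  enorm (grad2 g x y - grad2 g x' y') <= L * (enorm (x - x') + enorm (y - y')).
Proof.
move=> L0 [_ Lg]; rewrite !grad2E -raddfB.
apply: le_trans (enorm_rsub_le _) _; apply: le_trans (Lg _ _) _.
by rewrite opp_row_mx add_row_mx ler_wpM2l// enorm_row_mx_le.
Qed.

Section Average.
Context (n : nat) (fs : 'I_n -> 'rV[R]_(dx + dy) -> R) (L : R).
Hypothesis n0 : (0 < n)%N.
Hypothesis sfs : forall i, smooth L (fs i).

Let averageE : average fs = n%:R^-1 \*: (\sum_(i < n) fs i).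
Proof. by apply/funext => z /=; rewrite /average fct_sumE. Qed.

Lemma grad_average z : grad (average fs) z = n%:R^-1 *: \sum_(i < n) grad (fs i) z.
Proof.
have dfs j i : derivable (fs i) z (delta_mx 0 j).
  exact: diff_derivable ((sfs i).1 z).
apply/rowP => j; rewrite !mxE averageE summxE deriveZ; last exact: derivable_sum.
by rewrite derive_sum//; congr (_ *: _); apply: eq_bigr => i _; rewrite mxE.
Qed.

Lemma smooth_average : smooth L (average fs).
Proof.
split=> [z|z w].
  rewrite averageE; apply: differentiableZ; apply: differentiable_sum => i.
  exact: (sfs i).1.
rewrite !grad_average -scalerBr -sumrB enormZ ger0_norm ?invr_ge0//.
rewrite mulrC ler_pdivrMr ?ltr0n//.
apply: le_trans (enorm_sum _ _ _) _.
apply: le_trans (_ : \sum_(i < n) L * enorm (z - w) <= _).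
  by apply: ler_sum => i _; exact: (sfs i).2.
by rewrite sumr_const card_ord mulr_natr.
Qed.

Lemma grad1_average x y :
  \sum_(i < n) grad1 (fs i) x y = n%:R *: grad1 (average fs) x y.
Proof.
rewrite grad1E grad_average linearZ /= scalerA divff ?pnatr_eq0 -?lt0n//.
by rewrite scale1r linear_sum; apply: eq_bigr => i _; rewrite grad1E.
Qed.

Lemma grad2_average x y :
  \sum_(i < n) grad2 (fs i) x y = n%:R *: grad2 (average fs) x y.
Proof.
rewrite grad2E grad_average linearZ /= scalerA divff ?pnatr_eq0 -?lt0n//.
by rewrite scale1r linear_sum; apply: eq_bigr => i _; rewrite grad2E.
Qed.

End Average.
End Blocks.
End Gradient.

(** * The primal function *)

Section Primal.
Context (R : realType) (dx dy : nat) (f : 'rV[R]_(dx + dy) -> R) (L mu2 : R).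
Hypotheses (L0 : 0 < L) (sf : smooth L f) (mu20 : 0 < mu2).
Hypothesis argmaxf : forall x, argmax f x !=set0.
Hypothesis pl2 : forall x y, 2 * mu2 * (primal f x - f (row_mx x y))
  <= enorm (grad2 f x y) ^+ 2.
Local Notation Phi := (primal f).
Local Notation kappa2 := (L / mu2).
Implicit Types (x h : 'rV[R]_dx) (y : 'rV[R]_dy).

Lemma primal_argmax x y : argmax f x y -> Phi x = f (row_mx x y).
Proof.
move=> fy; apply/le_anti/andP; split.
  by apply: sup_le_ub; [exists (f (row_mx x y)), y|move=> _ [y' _ <-]; exact: fy].
apply: ub_le_sup; last by exists y.
by exists (f (row_mx x y)) => _ [y' _ <-]; exact: fy.
Qed.

Lemma primal_ge x y : f (row_mx x y) <= Phi x.
Proof. by have [y' fy'] := argmaxf x; rewrite (primal_argmax fy'); exact: fy'. Qed.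

(** A gradient-ascent step of length [1 / L] in [y] cannot exceed the maximum. *)
Lemma grad2_le_gap x y :
  enorm (grad2 f x y) ^+ 2 <= 2 * L * (Phi x - f (row_mx x y)).
Proof.
set w := grad2 f x y.
have := smooth_lower2 x y 0 (L^-1 *: w) sf.
rewrite addr0 -/w enorm0 expr0n/= enormZ exprMn dotvZr dotv0r.
rewrite -enorm_sqr real_normK ?num_real//.
have := primal_ge x (y + L^-1 *: w).
set N := enorm w ^+ 2; set G' := f (row_mx x (_ + _)); set G := f _ => h1.
have -> : G + 0 + L^-1 * N - L / 2 * (0 + L^-1 ^+ 2 * N)
    = G + N / (2 * L) by field; rewrite gt_eqF.
move=> h2; have : N / (2 * L) <= Phi x - G by lra.
by rewrite ler_pdivrMr ?mulr_gt0// mulrC.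
Qed.

Lemma grad2_argmax x y : argmax f x y -> grad2 f x y = 0.
Proof.
move=> fy; apply/enorm_eq0/eqP; rewrite -sqrf_eq0 eq_le sqr_ge0 andbT.
by have := grad2_le_gap x y; rewrite (primal_argmax fy) subrr mulr0.
Qed.

(** Moving [x] by [h] spoils the optimality of [y] by a gradient of size at most
    [L * |h|], and the PL inequality turns this into a gap quadratic in [h]. *)
Lemma primal_upper_argmax x y h : argmax f x y ->
  Phi (x + h) <= Phi x + dotv (grad1 f x y) h
                 + L * (1 + kappa2) / 2 * enorm h ^+ 2.
Proof.
move=> fy; have := pl2 (x + h) y; have := smooth_upper2 x y h 0 sf.
have := grad2_lip (x + h) y x y (ltW L0) sf.
rewrite (grad2_argmax fy) subr0 subrr enorm0 addr0 addrAC subrr add0r addr0.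
rewrite (primal_argmax fy) expr0n/= dotv0r.
rewrite !addr0.
set w := enorm (grad2 _ _ _); set e := enorm h => h1 h2.
have w0 : 0 <= w by exact: enorm_ge0.
have : w ^+ 2 <= (L * e) ^+ 2 by rewrite lerXn2r ?nnegrE// (le_trans w0).
move=> h3 h4.
have : Phi (x + h) - f (row_mx (x + h) y) <= (L * e) ^+ 2 / (2 * mu2).
  by rewrite ler_pdivlMr ?mulr_gt0// mulrC (le_trans h4).
have -> : (L * e) ^+ 2 / (2 * mu2) = L * kappa2 / 2 * e ^+ 2.
  by field; rewrite gt_eqF.
lra.
Qed.

Lemma primal_lower_argmax x y h : argmax f x y ->
  Phi x + dotv (grad1 f x y) h - L / 2 * enorm h ^+ 2 <= Phi (x + h).
Proof.
move=> fy; apply: le_trans (primal_ge _ y).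
have := smooth_lower2 x y h 0 sf.
rewrite (grad2_argmax fy) (primal_argmax fy) addr0 enorm0 expr0n/= addr0.
by rewrite dotv0r addr0.
Qed.

Lemma kappa2_ge0 : 0 <= kappa2.
Proof. by rewrite divr_ge0 ?ltW. Qed.

(** The primal function lies between two quadratics that touch at [x] with the
    slope of [f(.; y)], for any maximizer [y] (Danskin): its gradient exists
    although the maximizers need not depend continuously on [x]. *)
Lemma grad_primal x y : argmax f x y -> grad Phi x = grad1 f x y.
Proof.
move=> fy; apply: (@grad_of_quadratic_bound _ _ _ _ _ (L * (1 + kappa2) / 2)) => h.
have := primal_upper_argmax h fy; have := primal_lower_argmax h fy.
have := mulr_ge0 (mulr_ge0 (ltW L0) kappa2_ge0) (sqr_ge0 (enorm h)).
move=> h0 h1 h2; rewrite ler_norml; apply/andP; split; lra.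
Qed.

Lemma primal_upper x h :
  Phi (x + h) <= Phi x + dotv (grad Phi x) h + L * (1 + kappa2) / 2 * enorm h ^+ 2.
Proof.
by have [y fy] := argmaxf x; rewrite (grad_primal fy); exact: primal_upper_argmax.
Qed.

(** The gap [Phi - f(.; y)] is nonnegative and bounded above by a quadratic of
    curvature [L * (2 + kappa2)], so that its gradient is controlled by its value. *)
Lemma grad_gap_le x y :
  enorm (grad Phi x - grad1 f x y) ^+ 2
    <= 2 * (L * (2 + kappa2)) * (Phi x - f (row_mx x y)).
Proof.
set p := grad Phi x - grad1 f x y; set c := L * (2 + kappa2).
have c0 : 0 < c by rewrite mulr_gt0// ltr_wpDr ?kappa2_ge0 ?ltr0n.
pose h := - (c^-1 *: p).
have := primal_upper x h; have := smooth_lower2 x y h 0 sf.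
have := primal_ge (x + h) (y + 0).
rewrite enorm0 expr0n/= addr0 dotv0r !addr0.
move=> h1 h2 h3.
have : 0 <= Phi x - f (row_mx x y) + dotv p h + c / 2 * enorm h ^+ 2.
  rewrite /p dotvDl dotvNl /c; lra.
rewrite /h dotvNr dotvZr -enorm_sqr enormN enormZ exprMn real_normK ?num_real//.
set N := enorm p ^+ 2.
have -> : Phi x - f (row_mx x y) + - (c^-1 * N) + c / 2 * (c^-1 ^+ 2 * N) =
  Phi x - f (row_mx x y) - N / (2 * c) by field; rewrite gt_eqF.
by rewrite subr_ge0 ler_pdivrMr ?(mulr_gt0 _ c0)// mulrC.
Qed.

(** The PL inequality and [grad2_le_gap] bound the same squared gradient from both
    sides, which compares their constants as soon as one gap is positive. *)
Lemma mu2_le : ((forall x y, f (row_mx x y) = Phi x) -> mu2 <= L) -> mu2 <= L.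
Proof.
move=> degen; have [|] := pselect (forall x y, f (row_mx x y) = Phi x).
  exact: degen.
move=> /existsNP[x /existsNP[y /eqP fy]].
have gt0 : 0 < Phi x - f (row_mx x y) by rewrite subr_gt0 lt_neqAle fy primal_ge.
have := le_trans (pl2 x y) (grad2_le_gap x y).
by rewrite ler_pM2r// ler_pM2l.
Qed.

Section MinPrimal.
Context (mu1 : R).
Hypothesis lbPhi : has_lbound (range Phi).
Hypothesis pl1 : forall x, 2 * mu1 * (Phi x - primal_min f) <= enorm (grad Phi x) ^+ 2.

Lemma primal_min_le x : primal_min f <= Phi x.
Proof. by apply: ge_inf => //; exists x. Qed.

(** A gradient-descent step on the primal function cannot pass below its minimum. *)
Lemma grad_primal_le x :
  enorm (grad Phi x) ^+ 2 <= 2 * (L * (1 + kappa2)) * (Phi x - primal_min f).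
Proof.
set p := grad Phi x; set c := L * (1 + kappa2).
have c0 : 0 < c by rewrite mulr_gt0// ltr_wpDr ?kappa2_ge0.
have := primal_upper x (- (c^-1 *: p)); have := primal_min_le (x + - (c^-1 *: p)).
rewrite dotvNr dotvZr -enorm_sqr enormN enormZ exprMn real_normK ?num_real//.
set N := enorm p ^+ 2; rewrite -/c => h1 h2.
have := le_trans h1 h2.
have -> : Phi x + - (c^-1 * N) + c / 2 * (c^-1 ^+ 2 * N) =
  Phi x - N / (2 * c) by field; rewrite gt_eqF.
rewrite lerBrDr addrC -lerBrDr => h3.
by rewrite mulrC -ler_pdivrMr// (mulr_gt0 _ c0).
Qed.

Lemma mu1_le : ((forall x, Phi x = primal_min f) -> mu1 <= L) ->
  mu1 <= L * (1 + kappa2).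
Proof.
move=> degen; have [/degen/le_trans|] := pselect (forall x, Phi x = primal_min f).
  by apply; rewrite ler_pMr// lerDl kappa2_ge0.
move=> /existsNP[x /eqP fx].
have gt0 : 0 < Phi x - primal_min f.
  by rewrite subr_gt0 lt_neqAle eq_sym fx primal_min_le.
have := le_trans (pl1 x) (grad_primal_le x).
by rewrite ler_pM2r// ler_pM2l.
Qed.

End MinPrimal.
End Primal.

(** * Sampling without replacement *)

Section Sampling.
Context (R : realType) (n : nat).
Hypothesis n2 : (2 <= n)%N.
Local Notation N := (#|{: 'S_n}|%:R : R).

Section Scalar.
Context (h : 'I_n -> R).
Hypothesis h0 : \sum_i h i = 0.
(* [T j k] is the correlation of the positions [j] and [k], multiplied by the
   number of permutations. *)
Let T (j k : 'I_n) := \sum_(s : 'S_n) h (s j) * h (s k).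
Let D := N / n%:R * \sum_i h i ^+ 2.

Let nR0 : n%:R != 0 :> R.
Proof. by rewrite pnatr_eq0 -lt0n (ltn_trans _ n2). Qed.

Let n1R0 : n%:R - 1 != 0 :> R.
Proof. by rewrite subr_eq0 pnatr_eq1 gtn_eqF. Qed.

Let T_diag j : T j j = D.
Proof.
have eqT k : T k k = T j j.
  rewrite /T (reindex_inj (mulgI (tperm k j))); apply: eq_bigr => s _.
  by rewrite !permM tpermL.
have : \sum_k T k k = N * \sum_i h i ^+ 2.
  rewrite exchange_big /= (eq_bigr (fun=> \sum_i h i ^+ 2)).
    by rewrite sumr_const mulr_natl.
  move=> s _; rewrite [RHS](reindex_perm s).
  by apply: eq_bigr => i _; rewrite expr2.
rewrite (eq_bigr (fun=> T j j)) // sumr_const card_ord -[_ *+ n]mulr_natl => E.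
by apply: (mulfI nR0); rewrite E /D; field.
Qed.

Let T_row j : \sum_k T j k = 0.
Proof.
rewrite exchange_big big1//= => s _; rewrite -mulr_sumr.
have <- : \sum_i h i = \sum_i h (s i) by rewrite (reindex_perm s).
by rewrite h0 mulr0.
Qed.

(* The off-diagonal correlations in row [j] are all equal, since a transposition
   of two other positions exchanges them; their sum is minus the diagonal. *)
Let T_off j k : j != k -> T j k = - D / (n%:R - 1).
Proof.
move=> jk; have eqT i : i != j -> T j i = T j k.
  move=> ij; rewrite /T (reindex_inj (mulgI (tperm i k))).
  by apply: eq_bigr => s _; rewrite !permM tpermL tpermD// eq_sym.
have hc : \sum_(i : 'I_n) T j k = n%:R * T j k.
  by rewrite sumr_const card_ord mulr_natl.
have E : D + \sum_(i | i != j) T j k = 0.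
  apply: etrans (T_row j); rewrite [RHS](bigD1 j)// T_diag; congr (_ + _).
  by apply: eq_big => // i /eqT.
move: hc; rewrite (bigD1 j)//= => hc.
by apply: (mulfI n1R0); rewrite mulrCA divff// mulr1; lra.
Qed.

Lemma sampling_variance_scalar (J : {set 'I_n}) :
  \sum_(s : 'S_n) (\sum_(j in J) h (s j)) ^+ 2 =
  N * (#|J|%:R * (n%:R - #|J|%:R) / (n%:R * (n%:R - 1)) * \sum_i h i ^+ 2).
Proof.
have -> : \sum_(s : 'S_n) (\sum_(j in J) h (s j)) ^+ 2 =
    \sum_(j in J) \sum_(k in J) T j k.
  rewrite /T; under [RHS]eq_bigr do rewrite exchange_big.
  rewrite [RHS]exchange_big; apply: eq_bigr => s _ /=.
  rewrite expr2 mulr_suml; apply: eq_bigr => j _.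
  by rewrite mulr_sumr.
have row j : j \in J ->
    \sum_(k in J) T j k = D * ((n%:R - #|J|%:R) / (n%:R - 1)).
  move=> jJ; rewrite (bigD1 j)// T_diag.
  rewrite (eq_bigr (fun=> - D / (n%:R - 1))); last first.
    by move=> k /andP[_ kj]; rewrite T_off// eq_sym.
  have : \sum_(k in J) - D / (n%:R - 1) = #|J|%:R * (- D / (n%:R - 1)).
    by rewrite sumr_const mulr_natl.
  rewrite (bigD1 j)//= => /eqP; rewrite addrC eq_sym -subr_eq => /eqP <-.
  by field.
rewrite (eq_bigr _ row) sumr_const -mulr_natl /D; field.
by rewrite n1R0 nR0.
Qed.

End Scalar.

(** Sampling without replacement: distinct positions are negatively correlated,
    all with the same covariance, which is fixed by the fact that the values sum
    to zero. *)
Lemma sampling_variance d (h : 'I_n -> 'rV[R]_d) (J : {set 'I_n}) :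
  \sum_i h i = 0 ->
  \sum_(s : 'S_n) enorm (\sum_(j in J) h (s j)) ^+ 2 =
  N * (#|J|%:R * (n%:R - #|J|%:R) / (n%:R * (n%:R - 1))
       * \sum_i enorm (h i) ^+ 2).
Proof.
move=> h0; under eq_bigr do rewrite enorm_sum_sqr.
rewrite exchange_big /=; under [in RHS]eq_bigr do rewrite enorm_sum_sqr.
rewrite [X in _ * (_ * X)]exchange_big /= !mulr_sumr; apply: eq_bigr => c _.
rewrite -(@sampling_variance_scalar (fun i => h i 0 c)).
  by apply: eq_bigr => s _; rewrite summxE.
by rewrite -summxE h0 mxE.
Qed.

End Sampling.

(** * Drift of the iterates within an epoch *)

(** The mini-batches of an epoch are consecutive blocks of the shuffled order, so
    that the first [t] of them together are the image of an initial segment. *)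
Definition initial_positions (n m : nat) : {set 'I_n} := [set j : 'I_n | (j < m)%N].

Lemma card_initial_positions n m : (m <= n)%N -> #|initial_positions n m| = m.
Proof.
move=> mn; rewrite -sum1_card.
rewrite (eq_bigl (fun j : 'I_n => (j < m)%N)); last by move=> j; rewrite inE.
by rewrite -(big_ord_widen n (fun=> 1%N) mn) sum1_card card_ord.
Qed.

Section Minibatch.
Context (n b : nat) (s : 'S_n).
Local Notation J := (initial_positions n).

Lemma sum_minibatch (V : zmodType) (F : 'I_n -> V) t :
  \sum_(i in minibatch b s t) F i =
  \sum_(j in J (b * t.+1)) F (s j) - \sum_(j in J (b * t)) F (s j).
Proof.
rewrite /minibatch big_imset /=; last by move=> j k _ _; exact: perm_inj.
rewrite (big_setID (J (b * t)) (A := J (b * t.+1)))/=.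
have -> : J (b * t.+1) :&: J (b * t) = J (b * t).
  apply/finset.setIidPr/fintype.subsetP => j; rewrite !inE => /leq_trans; apply.
  by rewrite leq_mul2l leqnSn orbT.
rewrite addrAC subrr add0r; apply: eq_bigl => j.
by rewrite !inE -leqNgt.
Qed.

Lemma sum_minibatches (V : zmodType) (F : 'I_n -> V) m :
  \sum_(t < m) \sum_(i in minibatch b s t) F i = \sum_(j in J (b * m)) F (s j).
Proof.
elim: m => [|m IH].
  by rewrite big_ord0 muln0 big1// => j; rewrite inE.
by rewrite big_ord_recr /= IH sum_minibatch addrC subrK.
Qed.

Lemma card_minibatch t : (b * t.+1 <= n)%N -> #|minibatch b s t| = b.
Proof.
move=> tn; apply/eqP; rewrite -(eqr_nat int) -sum1_card natr_sum sum_minibatch.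
rewrite -!natr_sum !sum1_card !card_initial_positions//; last first.
  by rewrite (leq_trans _ tn)// leq_mul2l leqnSn orbT.
by rewrite -natrB ?leq_mul2l ?leqnSn ?orbT// -mulnBr subSnn muln1.
Qed.

End Minibatch.

(** One coordinate block of the iterates within an epoch: [a t i] is the gradient of
    the [i]-th component at step [t], [a0 i] the one at the start of the epoch, [g]
    the average of the [a0 i], and [dist t] the distance travelled so far. *)
Section Drift.
Context (R : realType) (n b q : nat) (s : 'S_n).
Hypotheses (bq : (b * q)%N = n) (b0 : (0 < b)%N) (q0 : (0 < q)%N).
Local Notation J := (initial_positions n).
Context (d : nat) (X : nat -> 'rV[R]_d) (gamma L : R) (dist : nat -> R).
Context (a : nat -> 'I_n -> 'rV[R]_d) (a0 : 'I_n -> 'rV[R]_d) (g : 'rV[R]_d).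
Hypothesis XS : forall t, (t < q)%N ->
  X t.+1 = X t + (gamma / b%:R) *: \sum_(i in minibatch b s t) a t i.
Hypothesis aL : forall t i, (t < q)%N -> enorm (a t i - a0 i) <= L * dist t.
Hypothesis sum_a0 : \sum_i a0 i = n%:R *: g.
Hypotheses (L0 : 0 <= L) (dist0 : forall t, 0 <= dist t).

Let bR : b%:R != 0 :> R. Proof. by rewrite pnatr_eq0 -lt0n. Qed.
Let qR : q%:R != 0 :> R. Proof. by rewrite pnatr_eq0 -lt0n. Qed.
Let nR : n%:R = b%:R * q%:R :> R. Proof. by rewrite -bq natrM. Qed.

(** With all gradients taken at the start of the epoch, [t] steps out of [q]
    produce the fraction [t / q] of a full-gradient step plus this deviation. It
    vanishes after the whole epoch: that is the benefit of reshuffling. *)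
Definition sampling_error t : 'rV[R]_d :=
  n%:R^-1 *: \sum_(j in J (b * t)) (a0 (s j) - g).

Lemma sampling_error_start : sampling_error 0 = 0.
Proof. by rewrite /sampling_error muln0 big1 ?scaler0// => j; rewrite inE. Qed.

Lemma sampling_error_end : sampling_error q = 0.
Proof.
rewrite /sampling_error bq.
have -> : \sum_(j in J n) (a0 (s j) - g) = \sum_j (a0 (s j) - g).
  by apply: eq_bigl => j; rewrite inE ltn_ord.
rewrite sumrB sumr_const card_ord.
have <- : \sum_j a0 j = \sum_j a0 (s j) by rewrite (reindex_perm s).
by rewrite sum_a0 scaler_nat subrr scaler0.
Qed.

(** The true iterates deviate from those driven by the gradients at the
    start of the epoch by the Lipschitz constant times the accumulated distances. *)
Lemma fixed_gradient_drift_le t : (t <= q)%N ->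
  enorm (X t - X 0%N - (gamma * q%:R) *: ((t%:R / q%:R) *: g + sampling_error t))
  <= `|gamma| * L * \sum_(u < t) dist u.
Proof.
move=> tq.
have -> : (gamma * q%:R) *: ((t%:R / q%:R) *: g + sampling_error t) =
    (gamma / b%:R) *: \sum_(j in J (b * t)) a0 (s j).
  rewrite /sampling_error sumrB sumr_const card_initial_positions; last first.
    by rewrite -bq leq_mul2l tq orbT.
  move: (\sum_(j in _) _) => S; rewrite -[g *+ _]scaler_nat.
  by apply/rowP => i; rewrite !mxE nR natrM; field; rewrite bR qR.
elim: t tq => [|t IH] tq.
  rewrite subrr muln0 big1 ?scaler0 ?subr0 ?enorm0 ?big_ord0 ?mulr0//.
  by move=> j; rewrite inE.
rewrite XS// -!sum_minibatches !big_ord_recr /= scalerDr.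
set S0 := \sum_(i < t) _; set Sa := \sum_(i in _) a t i; set Sb := \sum_(i in _) _.
have -> : X t + (gamma / b%:R) *: Sa - X 0%N
    - ((gamma / b%:R) *: S0 + (gamma / b%:R) *: Sb)
  = (X t - X 0%N - (gamma / b%:R) *: S0) + (gamma / b%:R) *: (Sa - Sb).
  by apply/rowP => i; rewrite !mxE; ring.
apply: le_trans (enormD _ _) _; rewrite mulrDr lerD//.
  by rewrite /S0 sum_minibatches IH// ltnW.
rewrite enormZ /Sa /Sb -sumrB normrM normfV normr_nat -!mulrA ler_wpM2l//.
rewrite mulrC ler_pdivrMr ?ltr0n//.
apply: le_trans (enorm_sum _ _ _) _.
apply: le_trans (_ : \sum_(i in minibatch b s t) L * dist t <= _).
  by apply: ler_sum => i _; exact: aL.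
rewrite sumr_const card_minibatch ?mulr_natr// -bq leq_mul2l tq orbT//.
Qed.

Local Notation D := (\sum_(t < q) dist t).

Lemma drift_le t : (t <= q)%N ->
  enorm (X t - X 0%N) <= `|gamma| * q%:R *
    (L / q%:R * D + t%:R / q%:R * enorm g + enorm (sampling_error t)).
Proof.
move=> tq; have := fixed_gradient_drift_le tq.
set w := (t%:R / q%:R) *: g + _ => h.
rewrite -(subrK ((gamma * q%:R) *: w) (X t - X 0%N)).
apply: le_trans (enormD _ _) _; rewrite -(addrA (L / q%:R * D)) mulrDr lerD//.
  apply: le_trans h _; have -> : `|gamma| * q%:R * (L / q%:R * D) =
    `|gamma| * L * D by field.
  rewrite ler_wpM2l ?mulr_ge0//.
  rewrite (big_ord_widen q dist tq) [leRHS](bigID (fun i : 'I_q => (i < t)%N))/=.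
  by rewrite lerDl sumr_ge0.
rewrite enormZ normrM normr_nat ler_wpM2l ?mulr_ge0//.
apply: le_trans (enormD _ _) _; rewrite enormZ ger0_norm//.
Qed.

(** Over a full epoch the sampling error is gone, and what remains of the deviation
    from a full-gradient step is the drift of the evaluation points only. *)
Lemma epoch_displacement : gamma != 0 ->
  exists2 u, X q - X 0%N = (gamma * q%:R) *: (g + u) & enorm u <= L / q%:R * D.
Proof.
move=> gamma0; have := fixed_gradient_drift_le (leqnn q).
rewrite divff// scale1r sampling_error_end addr0 => h.
exists ((gamma * q%:R)^-1 *: (X q - X 0%N) - g).
  by rewrite (addrC g) subrK scalerA divff ?scale1r// mulf_neq0.
have -> : (gamma * q%:R)^-1 *: (X q - X 0%N) - g =
    (gamma * q%:R)^-1 *: (X q - X 0%N - (gamma * q%:R) *: g).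
  by rewrite (scalerBr _ (X q - _)) scalerA mulVf ?scale1r// mulf_neq0.
rewrite enormZ normfV normrM normr_nat mulrC ler_pdivrMr; last first.
  by rewrite mulr_gt0 ?normr_gt0// ltr0n.
apply: le_trans h _.
have -> // : L / q%:R * D * (`|gamma| * q%:R) = `|gamma| * L * D by field.
Qed.

End Drift.

Lemma sqr_mean_le (R : realType) (q : nat) (x : nat -> R) : (0 < q)%N ->
  (q%:R^-1 * \sum_(t < q) x t) ^+ 2 <= q%:R^-1 * \sum_(t < q) x t ^+ 2.
Proof.
move=> q0; have qR : q%:R != 0 :> R by rewrite pnatr_eq0 -lt0n.
set S := \sum_(t < q) x t; set m := q%:R^-1 * S.
have : 0 <= \sum_(t < q) (x t - m) ^+ 2 by apply: sumr_ge0 => t _; exact: sqr_ge0.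
rewrite (eq_bigr (fun t : 'I_q => x t ^+ 2 + (m ^+ 2 + (- (2 * m)) * x t)));
  last by move=> t _; ring.
rewrite big_split/= big_split/= sumr_const card_ord -mulr_sumr -[_ *+ q]mulr_natl -/S.
have -> : q%:R * m ^+ 2 + - (2 * m) * S = - (q%:R * m ^+ 2) by rewrite /m; field.
by rewrite subr_ge0 => h; rewrite mulrC ler_pdivlMr ?ltr0n// mulrC.
Qed.

Section SamplingError.
Context (R : realType) (n b q d : nat) (a0 : 'I_n -> 'rV[R]_d) (g : 'rV[R]_d).
Hypotheses (n2 : (2 <= n)%N) (bq : (b * q)%N = n).
Hypothesis sum_a0 : \sum_i a0 i = n%:R *: g.
Context (V : R).
Hypothesis variance : n%:R^-1 * \sum_i enorm (a0 i - g) ^+ 2 <= V.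
Local Notation rho := ((n%:R - b%:R) / (n%:R - 1)).
Local Notation N := (#|{: 'S_n}|%:R : R).

(** A prefix of [m = b t] draws has variance proportional to [m (n - m)], which is
    at most [n (n - b)] for every multiple [m <= n] of [b]; this is where the factor
    [(n - b) / (n - 1)] comes from. *)
Lemma sampling_error_mean t : (t <= q)%N ->
  \sum_(s : 'S_n) enorm (sampling_error b s a0 g t) ^+ 2 <= N * (rho / n%:R * V).
Proof.
move=> tq; have nR : 0 < n%:R :> R by rewrite ltr0n (ltn_trans _ n2).
have n1R : 0 < n%:R - 1 :> R by rewrite subr_gt0 ltr1n.
have bn : (b <= n)%N.
  by rewrite -bq leq_pmulr// lt0n; apply: contraTneq n2 => q0; rewrite -bq q0 muln0.
have btn : (b * t <= n)%N by rewrite -bq leq_mul2l tq orbT.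
under eq_bigr do rewrite /sampling_error enormZ exprMn.
rewrite -mulr_sumr (sampling_variance n2 (h := fun i => a0 i - g)); last first.
  by rewrite sumrB sumr_const card_ord sum_a0 scaler_nat subrr.
rewrite card_initial_positions// mulrCA ler_wpM2l// real_normK ?num_real//.
set S := \sum_i _; have S0 : 0 <= S by apply: sumr_ge0 => i _; exact: sqr_ge0.
have h : (b * t)%:R * (n%:R - (b * t)%:R) <= n%:R * (n%:R - b%:R) :> R.
  case: t tq btn => [|t] _ btn.
    by rewrite muln0 mul0r mulr_ge0 ?(ltW nR)// subr_ge0 ler_nat.
  rewrite ler_pM ?subr_ge0 ?ler_nat// lerD2l lerN2 ler_nat.
  by rewrite mulnS leq_addr.
apply: le_trans (_ : n%:R^-1 ^+ 2 * (n%:R * (n%:R - b%:R) / (n%:R * (n%:R - 1)) * S)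
  <= _).
  rewrite ler_wpM2l ?sqr_ge0// ler_wpM2r// ler_wpM2r// invr_ge0.
  by rewrite mulr_ge0 ?ltW.
have -> : n%:R^-1 ^+ 2 * (n%:R * (n%:R - b%:R) / (n%:R * (n%:R - 1)) * S) =
    rho / n%:R * (n%:R^-1 * S) by field; rewrite !gt_eqF.
by rewrite ler_wpM2l// divr_ge0 ?ler0n// divr_ge0 ?(ltW n1R)// subr_ge0 ler_nat.
Qed.

(** As the sampling error is zero both at [t = 0] and at [t = q], the range
    [0 <= t < q] may be traded for [1 <= t <= q]. *)
Definition mean_sampling_error (s : 'S_n) : R :=
  q%:R^-1 * \sum_(t < q) enorm (sampling_error b s a0 g t).

Lemma mean_sampling_error_ge0 s : 0 <= mean_sampling_error s.
Proof. by rewrite mulr_ge0 ?invr_ge0// sumr_ge0// => t _; exact: enorm_ge0. Qed.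

Lemma mean_sampling_error_sqr : (0 < q)%N ->
  \sum_(s : 'S_n) mean_sampling_error s ^+ 2 <= N * (rho / n%:R * V).
Proof.
move=> q0.
apply: le_trans (_ : \sum_(s : 'S_n)
    q%:R^-1 * \sum_(t < q) enorm (sampling_error b s a0 g t) ^+ 2 <= _).
  apply: ler_sum => s _.
  exact: (sqr_mean_le (fun t => enorm (sampling_error b s a0 g t))).
rewrite -mulr_sumr exchange_big/= mulrC ler_pdivrMr ?ltr0n//.
apply: le_trans (_ : \sum_(t < q) N * (rho / n%:R * V) <= _).
  by apply: ler_sum => t _; apply: sampling_error_mean; exact: ltnW.
by rewrite sumr_const card_ord mulr_natr.
Qed.

End SamplingError.

Section Epoch.
Context (R : realType) (dx dy n b q : nat) (v : sgda_variant).
Context (fs : 'I_n -> 'rV[R]_(dx + dy) -> R) (L alpha beta : R).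
Context (z0 : 'rV[R]_dx * 'rV[R]_dy) (s : 'S_n).
Hypotheses (bq : (b * q)%N = n) (b0 : (0 < b)%N) (q0 : (0 < q)%N).
Hypotheses (L0 : 0 < L) (sfs : forall i, smooth L (fs i)).
Hypotheses (alpha0 : 0 < alpha) (beta0 : 0 < beta).
Hypothesis step : L * (alpha * q%:R) + L * (beta * q%:R) <= 5^-1.
Local Notation x0 := z0.1.
Local Notation y0 := z0.2.
Let a1 i := grad1 (fs i) x0 y0.
Let a2 i := grad2 (fs i) x0 y0.
Let g := grad1 (average fs) x0 y0.
Let w := grad2 (average fs) x0 y0.

Let traj t := foldl (sgda_step v fs b alpha beta s) z0 (iota 0 t).
Let X t := (traj t).1.
Let Y t := (traj t).2.
(* The first argument at which the gradients in [y] are evaluated. *)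
Let X' t := if v is SimSGDA then X t else X t.+1.

Let trajS t : traj t.+1 = sgda_step v fs b alpha beta s (traj t) t.
Proof. by rewrite /traj -[t.+1]addn1 iotaD foldl_cat. Qed.

Let XS t : X t.+1 = X t + (- alpha / b%:R) *:
  \sum_(i in minibatch b s t) grad1 (fs i) (X t) (Y t).
Proof.
by rewrite /X /Y trajS /sgda_step; case: (traj t) => x y /=; rewrite mulNr scaleNr.
Qed.

Let YS t : Y t.+1 = Y t + (beta / b%:R) *:
  \sum_(i in minibatch b s t) grad2 (fs i) (X' t) (Y t).
Proof. by rewrite /Y /X' /X trajS /sgda_step; case: v; case: (traj t). Qed.

Let DX := \sum_(t < q) enorm (X t.+1 - x0).
Let DY := \sum_(t < q) enorm (Y t - y0).
Let e := L / q%:R * (DX + DY).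

Let sum_shift (phi : nat -> R) : phi 0%N = 0 -> (forall t, 0 <= phi t) ->
  \sum_(t < q) phi t <= \sum_(t < q) phi t.+1.
Proof.
move=> phi0 phige; have : \sum_(t < q.+1) phi t = \sum_(t < q) phi t.+1.
  by rewrite big_ord_recl phi0 add0r.
by rewrite big_ord_recr /= => <-; rewrite lerDl.
Qed.

Let X0 : X 0%N = x0. Proof. by []. Qed.
Let Y0 : Y 0%N = y0. Proof. by []. Qed.
Let distX t := enorm (X t - x0) + enorm (Y t - y0).
Let distY t := enorm (X' t - x0) + enorm (Y t - y0).

Let distX_sum : \sum_(t < q) distX t <= DX + DY.
Proof.
rewrite big_split lerD2r /=.
apply: (sum_shift (phi := fun t => enorm (X t - x0))) => [|t].
  by rewrite X0 subrr enorm0.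
exact: enorm_ge0.
Qed.

Let distY_sum : \sum_(t < q) distY t <= DX + DY.
Proof.
rewrite /distY /X'; have := distX_sum; rewrite /distX.
by case: (v) => // _; rewrite big_split.
Qed.

Let qR : q%:R != 0 :> R. Proof. by rewrite pnatr_eq0 -lt0n. Qed.

Let n0 : (0 < n)%N. Proof. by rewrite -bq muln_gt0 b0. Qed.

Let aLX t i : (t < q)%N -> enorm (grad1 (fs i) (X t) (Y t) - a1 i) <= L * distX t.
Proof. by move=> _; apply: grad1_lip; [exact: ltW|]. Qed.

Let aLY t i : (t < q)%N -> enorm (grad2 (fs i) (X' t) (Y t) - a2 i) <= L * distY t.
Proof. by move=> _; apply: grad2_lip; [exact: ltW|]. Qed.

Let sum_a1 : \sum_i a1 i = n%:R *: g. Proof. exact: grad1_average sfs _ _. Qed.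
Let sum_a2 : \sum_i a2 i = n%:R *: w. Proof. exact: grad2_average sfs _ _. Qed.
Let distX0 t : 0 <= distX t. Proof. by rewrite addr_ge0 ?enorm_ge0. Qed.
Let distY0 t : 0 <= distY t. Proof. by rewrite addr_ge0 ?enorm_ge0. Qed.
Let N1 := mean_sampling_error b q a1 g s.
Let N2 := mean_sampling_error b q a2 w s.

Let DX_le : DX <= q%:R * (alpha * q%:R * (e + enorm g + N1)).
Proof.
have h (t : 'I_q) : true -> enorm (X t.+1 - x0) <= alpha * q%:R * (e + enorm g)
    + alpha * q%:R * enorm (sampling_error b s a1 g t.+1).
  move=> _; have := drift_le bq b0 q0 g (fun t _ => XS t) aLX (ltW L0) distX0
    (ltn_ord t).
  rewrite X0 normrN (gtr0_norm alpha0) => /le_trans; apply.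
  rewrite -mulrDr ler_wpM2l ?mulr_ge0 ?(ltW alpha0)// lerD2r lerD//.
    by rewrite ler_wpM2l// divr_ge0// ltW.
  by rewrite ler_piMl ?enorm_ge0// ler_pdivrMr ?ltr0n// mul1r ler_nat.
apply: le_trans (ler_sum _ h) _; rewrite big_split/= sumr_const card_ord -mulr_sumr.
have -> : \sum_(i < q) enorm (sampling_error b s a1 g i.+1) = q%:R * N1.
  rewrite mulrA divff// mul1r.
  have E : \sum_(t < q.+1) enorm (sampling_error b s a1 g t) =
      \sum_(t < q) enorm (sampling_error b s a1 g t.+1).
    by rewrite big_ord_recl sampling_error_start enorm0 add0r.
  by rewrite -E big_ord_recr /= (sampling_error_end _ bq sum_a1) enorm0 addr0.
rewrite -[_ *+ q]mulr_natl le_eqVlt; apply/orP; left; apply/eqP; ring.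
Qed.

Let DY_le : DY <= q%:R * (beta * q%:R * (e + enorm w / 2 + N2)).
Proof.
have h (t : 'I_q) : true -> enorm (Y t - y0) <= beta * q%:R * e +
    beta * enorm w * t%:R + beta * q%:R * enorm (sampling_error b s a2 w t).
  move=> _; have := drift_le bq b0 q0 w (fun t _ => YS t) aLY (ltW L0) distY0
    (ltnW (ltn_ord t)).
  rewrite Y0 (gtr0_norm beta0) => /le_trans; apply.
  rewrite 2!mulrDr lerD2r lerD//.
    rewrite ler_wpM2l ?mulr_ge0 ?(ltW beta0)//.
    by rewrite ler_wpM2l// divr_ge0// ltW.
  by have -> // : beta * q%:R * (t%:R / q%:R * enorm w) = beta * enorm w * t%:R
    by field.
apply: le_trans (ler_sum _ h) _.
rewrite big_split/= big_split/= sumr_const card_ord -!mulr_sumr.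
have -> : \sum_(t < q) enorm (sampling_error b s a2 w t) = q%:R * N2.
  by rewrite mulrA divff// mul1r.
have ht : \sum_(t < q) t%:R <= q%:R * q%:R / 2 :> R.
  elim: q => [|m IH]; first by rewrite big_ord0 mul0r mul0r.
  rewrite big_ord_recr /= -natr1; lra.
have := ler_wpM2l (mulr_ge0 (ltW beta0) (enorm_ge0 w)) ht.
rewrite -[_ *+ q]mulr_natl; lra.
Qed.

(** The drift feeds on itself, since the gradients are evaluated at the
    drifted points; as the step sizes are small, the self-reference is absorbed
    at the price of a constant factor. *)
Lemma epoch_displacements :
  let z := sgda_epoch v fs b alpha beta z0 s in
  exists u w' err, [/\ z.1 = x0 - (alpha * q%:R) *: (g + u),
    z.2 = y0 + (beta * q%:R) *: (w + w'), enorm u <= err, enorm w' <= err &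
    err <= 5 / 4 * (L * (beta * q%:R) * (enorm w / 2 + N2)
                    + L * (alpha * q%:R) * (enorm g + N1))].
Proof.
have zE : sgda_epoch v fs b alpha beta z0 s = traj q.
  by rewrite /sgda_epoch /traj; congr (foldl _ _ (iota 0 _)); rewrite -bq mulKn.
have [|u Xu ub] := epoch_displacement bq b0 q0 (fun t _ => XS t) aLX sum_a1.
  by rewrite oppr_eq0 gt_eqF.
have [|w' Yw wb] := epoch_displacement bq b0 q0 (fun t _ => YS t) aLY sum_a2.
  by rewrite gt_eqF.
have Lq : 0 <= L / q%:R by rewrite divr_ge0// ltW.
exists u, w', e; split.
- rewrite zE -/(X q); move/eqP: Xu; rewrite subr_eq addrC => /eqP ->.
  by rewrite mulNr scaleNr.
- by rewrite zE -/(Y q); move/eqP: Yw; rewrite subr_eq addrC => /eqP ->.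
- by apply: le_trans ub _; rewrite ler_wpM2l.
- by apply: le_trans wb _; rewrite ler_wpM2l.
have e0 : 0 <= e by rewrite mulr_ge0// addr_ge0// sumr_ge0// => t _; exact: enorm_ge0.
(* [e] occurs on both sides, with total coefficient at most 1/5 on the right. *)
have : e <= L * (alpha * q%:R) * (e + enorm g + N1)
          + L * (beta * q%:R) * (e + enorm w / 2 + N2).
  apply: le_trans (ler_wpM2l Lq (lerD DX_le DY_le)) _.
  by rewrite le_eqVlt; apply/orP; left; apply/eqP; field.
have := ler_wpM2r e0 step; lra.
Qed.

End Epoch.

(** * Descent of the potential over an epoch *)

Section QuadraticForms.
Context (R : realType) (d : nat).
Implicit Types F p u w v : 'rV[R]_d.

(** The weights are those of one epoch in the [x] direction: 10 comes from the
    factor 5 of the primal function in the potential, 2 from [- f], and 1/5 bounds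
    the curvature terms. Here [F] is the primal gradient, [F - p] the gradient of
    [f] in [x] and [u] the drift. Of the coefficient 49/20, a part 2 pays for the
    contraction and the rest for the drift; the other two coefficients are then
    large enough for the difference of both sides to be a sum of squares. *)
Lemma primal_direction_le F p u :
  - 10 * dotv F (F - p + u) + 2 * dotv (F - p) (F - p + u)
    + 5^-1 * enorm (F - p + u) ^+ 2
  <= - (49 / 20) * enorm F ^+ 2 + 9 / 2 * enorm p ^+ 2 + 16 * enorm u ^+ 2.
Proof.
(* Completing the square in [F] gives the first vector. What remains is a
   quadratic form in [p] and [u], a positive combination of the other squares. *)
have := dotvv_ge0 (F - (56 / 107) *: p + (76 / 107) *: u).
have := dotvv_ge0 (p + (38 / 10) *: u); have := dotvv_ge0 (p + (39 / 10) *: u).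
have := dotvv_ge0 u.
rewrite !enorm_sqr !dotvE (dotvC u F) (dotvC p F) (dotvC u p); lra.
Qed.

Lemma dual_direction_le w v :
  - 2 * dotv w (w + v) + 6^-1 * enorm (w + v) ^+ 2
  <= - (3 / 2) * enorm w ^+ 2 + 5 / 2 * enorm v ^+ 2.
Proof.
have := dotvv_ge0 (w + (5 / 2) *: v); have := dotvv_ge0 v.
rewrite !enorm_sqr !dotvE (dotvC v w); lra.
Qed.

End QuadraticForms.

Section Descent.
Context (R : realType) (dx dy : nat) (f : 'rV[R]_(dx + dy) -> R).
Context (L mu2 r eta : R).
Hypotheses (L0 : 0 < L) (sf : smooth L f) (mu20 : 0 < mu2).
Hypothesis argmaxf : forall x, argmax f x !=set0.
Hypothesis pl2 : forall x y, 2 * mu2 * (primal f x - f (row_mx x y))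
  <= enorm (grad2 f x y) ^+ 2.
Local Notation Phi := (primal f).
Local Notation V := (potential 4 f).
Local Notation kappa2 := (L / mu2).
Hypothesis kappa2_ge1 : 1 <= kappa2.
Hypothesis r_ge : 14 * kappa2 ^+ 2 <= r.
Hypotheses (eta0 : 0 < eta) (eta_le : L * eta <= 6^-1).

Let kappa2_sqr : kappa2 <= kappa2 ^+ 2.
Proof. by rewrite expr2 ler_peMl// (le_trans ler01). Qed.
Let r14 : 14 <= r. Proof. have := (kappa2_ge1, kappa2_sqr, r_ge) => -[[]]; lra. Qed.
Let r0 : 0 < r. Proof. have := r14; lra. Qed.

Lemma potential_descent x y u v (F := grad Phi x) (g := grad1 f x y)
    (w := grad2 f x y) :
  V (x - (eta / r) *: (g + u), y + eta *: (w + v)) <= V (x, y)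
    + eta / r / 2 * (- (49 / 20) * enorm F ^+ 2 + 9 / 2 * enorm (F - g) ^+ 2
                     + 16 * enorm u ^+ 2)
    + eta / 2 * (- (3 / 2) * enorm w ^+ 2 + 5 / 2 * enorm v ^+ 2).
Proof.
rewrite /potential /=.
have etax0 : 0 < eta / r by rewrite divr_gt0.
have := primal_upper L0 sf mu20 argmaxf pl2 x (- ((eta / r) *: (g + u))).
have := smooth_lower2 x y (- ((eta / r) *: (g + u))) (eta *: (w + v)) sf.
rewrite -/F -/g -/w !dotvNr !dotvZr !enormN !enormZ !exprMn !real_normK ?num_real//.
have := primal_direction_le F (F - g) u; rewrite opprB addrCA subrr addr0.
have := dual_direction_le w v.
set a := enorm (g + u) ^+ 2; set c := enorm (w + v) ^+ 2.
have a0 : 0 <= a by exact: sqr_ge0.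
have c0 : 0 <= c by exact: sqr_ge0.
(* The curvatures along [x]: [L] from [f], and [5 L (1 + kappa2)] from [5 Phi]. *)
have s1 : (L * (eta / r) * 6 + 5 * kappa2 * (L * (eta / r))) <= 5^-1.
  have e1 : L * (eta / r) <= 6^-1 / r by rewrite mulrA ler_wpM2r// invr_ge0 ltW.
  have e2 : kappa2 / r <= 14^-1.
    by rewrite ler_pdivrMr//; move: kappa2_sqr r_ge; lra.
  have e3 : r^-1 <= 14^-1 by rewrite lef_pV2 ?posrE.
  have := ler_wpM2l (le_trans ler01 kappa2_ge1) e1; lra.
have := ler_wpM2l (mulr_ge0 (ltW etax0) a0) s1.
have := ler_wpM2l (mulr_ge0 (ltW eta0) c0) eta_le.
move=> h1 h2 h3 h4 h5 h6.
have {}h3 := ler_wpM2l (ltW eta0) h3; have {}h4 := ler_wpM2l (ltW etax0) h4.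
lra.
Qed.

(** Since [r >= 14 kappa2 ^ 2], the errors of the slow variable, once divided by
    [r], fit into the decrease [3/2 * w2] of the fast one; this is what two time
    scales are for. Here [F2], [p2], [g2], [w2] stand for the squared norms of the
    gradient of the primal function, of its difference to the partial gradient in
    [x], and of the two partial gradients; [H] is the mean squared drift. *)
Lemma descent_budget (F2 p2 g2 w2 H noise : R) :
  0 <= F2 -> 0 <= w2 -> 0 <= noise -> g2 <= 2 * (F2 + p2) ->
  p2 <= 3 * kappa2 ^+ 2 * w2 ->
  H <= 25 / 16 * (25 / 16 * (w2 / 36 + noise)
                  + 10 * (g2 / 36 / r ^+ 2 + noise / r ^+ 2)) ->
  eta / r / 2 * (- (49 / 20) * F2 + 9 / 2 * p2 + 16 * H)
    + eta / 2 * (- (3 / 2) * w2 + 5 / 2 * H)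
  <= - (eta / r) * F2 - eta / 28 * w2 + 5 * eta * noise.
Proof.
move=> F0 w0 nz0 gF pw Hle.
have ri0 : 0 < r^-1 by rewrite invr_gt0.
have ri : r^-1 <= 14^-1 by rewrite lef_pV2 ?posrE.
have pr : p2 / r <= 3 / 14 * w2.
  rewrite ler_pdivrMr//; apply: le_trans pw _.
  have := ler_wpM2r w0 r_ge; lra.
have prr : p2 / r ^+ 2 <= 3 / 196 * w2.
  have -> : p2 / r ^+ 2 = p2 / r * r^-1 by field; rewrite gt_eqF.
  have [/ltW pneg|ppos] := ltP (p2 / r) 0.
    apply: le_trans (_ : 0 <= _); last by rewrite mulr_ge0.
    by rewrite mulr_le0_ge0// ltW.
  have := ler_wpM2l ppos ri; lra.
have Frr : F2 / r ^+ 2 <= F2 / r / 14.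
  have -> : F2 / r ^+ 2 = F2 / r * r^-1 by field; rewrite gt_eqF.
  by rewrite ler_wpM2l// divr_ge0// ltW.
have grr : g2 / r ^+ 2 <= 2 * (F2 / r / 14 + 3 / 196 * w2).
  apply: le_trans (_ : 2 * (F2 + p2) / r ^+ 2 <= _).
    by rewrite ler_wpM2r// invr_ge0 sqr_ge0.
  lra.
have nrr : noise / r ^+ 2 <= noise / 196.
  rewrite ler_wpM2l// lef_pV2 ?posrE ?exprn_gt0//.
  have : 14 ^+ 2 <= r ^+ 2 by rewrite lerXn2r ?nnegrE// ltW.
  lra.
have Fr0 : 0 <= F2 / r by rewrite divr_ge0// ltW.
(* The coefficients are those of [Hle], rounded up. *)
have HF : H <= 82 / 1000 * w2 + 63 / 1000 * (F2 / r) + 254 / 100 * noise by lra.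
pose H' := 82 / 1000 * w2 + 63 / 1000 * (F2 / r) + 254 / 100 * noise.
have H'0 : 0 <= H' by rewrite /H'; lra.
have Hr : H / r <= H' / 14.
  apply: le_trans (ler_wpM2r (ltW ri0) HF) _; exact: ler_wpM2l.
have -> : eta / r / 2 * (- (49 / 20) * F2 + 9 / 2 * p2 + 16 * H)
    + eta / 2 * (- (3 / 2) * w2 + 5 / 2 * H) =
  eta / 2 * (- (49 / 20) * (F2 / r) + 9 / 2 * (p2 / r) + 16 * (H / r)
             - 3 / 2 * w2 + 5 / 2 * H) by field; rewrite gt_eqF.
have -> : - (eta / r) * F2 - eta / 28 * w2 + 5 * eta * noise =
  eta / 2 * (- 2 * (F2 / r) - w2 / 14 + 10 * noise) by field; rewrite gt_eqF.
rewrite ler_wpM2l ?divr_ge0 ?(ltW eta0)//; move: Hr; rewrite /H'; lra.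
Qed.

End Descent.

Section EpochDescent.
Context (R : realType) (dx dy n b q : nat) (v : sgda_variant).
Context (fs : 'I_n -> 'rV[R]_(dx + dy) -> R).
Context (L A B mu1 mu2 r alpha beta : R).
Hypotheses (n2 : (2 <= n)%N) (bq : (b * q)%N = n) (b0 : (0 < b)%N) (q0 : (0 < q)%N).
Hypotheses (L0 : 0 < L) (sfs : forall i, smooth L (fs i)) (A0 : 0 <= A) (B0 : 0 <= B).
Local Notation f := (average fs).
Local Notation Phi := (primal f).
Local Notation V := (potential 4 f).
Local Notation kappa2 := (L / mu2).
Local Notation rho := ((n%:R - b%:R) / (n%:R - 1)).
Local Notation eta := (beta * q%:R).
Hypothesis variance1 : forall x y, n%:R^-1 * \sum_(i < n)
       enorm (grad1 (fs i) x y - grad1 f x y) ^+ 2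
     <= A * enorm (grad1 f x y) ^+ 2 + B.
Hypothesis variance2 : forall x y, n%:R^-1 * \sum_(i < n)
       enorm (grad2 (fs i) x y - grad2 f x y) ^+ 2
     <= A * enorm (grad2 f x y) ^+ 2 + B.
Hypothesis argmaxf : forall x, argmax f x !=set0.
Hypothesis mu20 : 0 < mu2.
Hypothesis pl2 : forall x y, 2 * mu2 * (Phi x - f (row_mx x y))
  <= enorm (grad2 f x y) ^+ 2.
Hypothesis pl1 : forall x, 2 * mu1 * (Phi x - primal_min f) <= enorm (grad Phi x) ^+ 2.
Hypotheses (mu2L : mu2 <= L) (mu1L : mu1 <= L * (1 + kappa2)).
Hypothesis r_ge : 14 * kappa2 ^+ 2 <= r.
Hypotheses (beta0 : 0 < beta) (alphaE : alpha = beta / r).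
Hypothesis step : (L * eta) ^+ 2 * (1 + rho * (A / n%:R)) <= 36^-1.

Let n0 : (0 < n)%N. Proof. exact: ltn_trans n2. Qed.
Let sf : smooth L f. Proof. exact: smooth_average. Qed.

Let kappa2_ge1 : 1 <= kappa2. Proof. by rewrite ler_pdivlMr// mul1r. Qed.

Let kappa2_sqr : kappa2 <= kappa2 ^+ 2.
Proof. by rewrite expr2 ler_peMl// (le_trans ler01). Qed.
Let r14 : 14 <= r. Proof. have := (kappa2_ge1, kappa2_sqr, r_ge) => -[[]]; lra. Qed.
Let r0 : 0 < r. Proof. have := r14; lra. Qed.
Let eta0 : 0 < eta. Proof. by rewrite mulr_gt0// ltr0n. Qed.

Lemma rho_ge0 : 0 <= rho :> R.
Proof.
by rewrite divr_ge0// subr_ge0 ?ler1n// ler_nat -bq leq_pmulr.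
Qed.

Let eta_le : L * eta <= 6^-1.
Proof.
have Le : 0 <= L * eta by rewrite mulr_ge0 ?ltW.
rewrite -(@ler_pXn2r _ 2) ?nnegrE//; apply: le_trans (_ : 36^-1 <= _); last lra.
apply: le_trans step; rewrite ler_peMr ?sqr_ge0// lerDl.
by rewrite mulr_ge0 ?rho_ge0// divr_ge0.
Qed.

(** The two PL inequalities turn the decrease by squared gradients into a decrease
    proportional to the potential; the gap of the fast variable only needs a small
    part of it, because [7 mu1 <= r mu2]. *)
Lemma potential_le_gradients x y :
  eta * mu1 / (2 * r) * V (x, y) <= eta / r * enorm (grad Phi x) ^+ 2
    + eta / 28 * enorm (grad2 f x y) ^+ 2.
Proof.
rewrite /potential /=.
have := ler_wpM2l (divr_ge0 (ltW eta0) (ltW r0)) (pl1 x).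
have := ler_wpM2l (ltW eta0) (pl2 x y).
have G0 : 0 <= Phi x - f (row_mx x y) by rewrite subr_ge0; exact: primal_ge.
have : mu1 / r <= mu2 / 7.
  rewrite ler_pdivrMr//; apply: le_trans mu1L _.
  have h : mu2 * (14 * kappa2 ^+ 2) <= mu2 * r by rewrite ler_pM2l.
  have E : mu2 * kappa2 = L by rewrite mulrC divfK// gt_eqF.
  have := ler_wpM2l (ltW L0) kappa2_ge1.
  move: h; rewrite expr2 (_ : mu2 * (14 * _) = 14 * (mu2 * kappa2 * kappa2)); last ring.
  rewrite E; lra.
move=> /(ler_wpM2r G0)/(ler_wpM2l (ltW eta0)) h1 h2 h3.
have -> : eta * mu1 / (2 * r) = eta * (mu1 / r) / 2 by field; rewrite gt_eqF.
lra.
Qed.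

Local Notation N := (#|{: 'S_n}|%:R : R).

(* The variance proportional to the squared gradient is absorbed by the factor
   [1 + rho * A / n] in the bound on the step size. *)
Let mean_square_budget (m a : R) : 0 <= m -> 0 <= a ->
  (L * eta) ^+ 2 * (m * a + m * (rho / n%:R * (A * a + B)))
  <= m * (a / 36 + (L * eta) ^+ 2 * (rho * B / n%:R)).
Proof. by move=> m0 a0; have := ler_wpM2l m0 (ler_wpM2r a0 step); lra. Qed.

(** One epoch contracts the expected potential up to a noise of third order in the
    step size. *)
Lemma epoch_descent z : \sum_(s : 'S_n) V (sgda_epoch v fs b alpha beta z s)
  <= N * ((1 - eta * mu1 / (2 * r)) * V z
          + 5 * eta * ((L * eta) ^+ 2 * (rho * B / n%:R))).
Proof.
case: z => x y.
set F := grad Phi x; set g := grad1 f x y; set w := grad2 f x y.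
pose N1 s := mean_sampling_error b q (fun i => grad1 (fs i) x y) g s.
pose N2 s := mean_sampling_error b q (fun i => grad2 (fs i) x y) w s.
pose E s := 25 / 16 * (25 / 16 * (L * eta) ^+ 2 * (enorm w ^+ 2 + N2 s ^+ 2)
    + 10 * (L * eta / r) ^+ 2 * (enorm g ^+ 2 + N1 s ^+ 2)).
have alpha0 : 0 < alpha by rewrite alphaE divr_gt0.
have aE : alpha * q%:R = eta / r by rewrite alphaE mulrAC.
have stepxy : L * (alpha * q%:R) + L * eta <= 5^-1.
  have Le0 : 0 <= L * eta by rewrite mulr_ge0 ?ltW.
  rewrite aE mulrA; have : L * eta / r <= 6^-1 / 14.
    apply: ler_pM eta_le _ => //; first by rewrite invr_ge0 ltW.
    by rewrite lef_pV2 ?posrE.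
  have := eta_le; lra.
have one s : V (sgda_epoch v fs b alpha beta (x, y) s) <= V (x, y)
    + eta / r / 2 * (- (49 / 20) * enorm F ^+ 2 + 9 / 2 * enorm (F - g) ^+ 2
                     + 16 * E s)
    + eta / 2 * (- (3 / 2) * enorm w ^+ 2 + 5 / 2 * E s).
  have [u [w' [err [/= zx zy ule wle]]]] :=
    epoch_displacements v (x, y) s bq b0 q0 L0 sfs alpha0 beta0 stepxy.
  rewrite -/g -/w -/(N1 s) -/(N2 s) aE => errle.
  rewrite (surjective_pairing (sgda_epoch _ _ _ _ _ _ _)) zx zy aE.
  apply: le_trans (potential_descent L0 sf mu20 argmaxf pl2 kappa2_ge1 r_ge eta0
    eta_le x y u w') _.
  have N10 : 0 <= N1 s by exact: mean_sampling_error_ge0.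
  have N20 : 0 <= N2 s by exact: mean_sampling_error_ge0.
  have err0 : 0 <= err by exact: le_trans (enorm_ge0 _) ule.
  have errE : err ^+ 2 <= E s.
    apply: le_trans (_ : (5 / 4 * (L * eta * (enorm w / 2 + N2 s) +
      L * (eta / r) * (enorm g + N1 s))) ^+ 2 <= _).
      by rewrite lerXn2r ?nnegrE// (le_trans err0).
    (* Young: [(a + b) ^ 2 <= 5/4 a ^ 2 + 5 b ^ 2], where [b] is the small term. *)
    rewrite /E; set eps := L * eta; set eta' := L * (eta / r).
    have -> : eps / r = eta' by rewrite /eps /eta' (mulrA L eta).
    have h1 := mulr_ge0 (sqr_ge0 eps) (sqr_ge0 (enorm w - N2 s / 2)).
    have h2 := mulr_ge0 (sqr_ge0 eta') (sqr_ge0 (enorm g - N1 s)).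
    have := sqr_ge0 (eps * (enorm w / 2 + N2 s) - 4 * (eta' * (enorm g + N1 s))).
    lra.
  have uE : enorm u ^+ 2 <= E s.
    by apply: le_trans errE; rewrite lerXn2r ?nnegrE ?enorm_ge0.
  have wE : enorm w' ^+ 2 <= E s.
    by apply: le_trans errE; rewrite lerXn2r ?nnegrE ?enorm_ge0.
  rewrite -/F -/g -/w; apply: lerD.
    rewrite lerD2l ler_wpM2l ?divr_ge0 ?(ltW eta0) ?(ltW r0)//; lra.
  by rewrite ler_wpM2l ?divr_ge0 ?(ltW eta0)//; lra.
pose H := N^-1 * \sum_(s : 'S_n) E s.
have Npos : 0 < N by rewrite ltr0n; apply/card_gt0P; exists 1%g.
have Hle : H <= 25 / 16 *
    (25 / 16 * (enorm w ^+ 2 / 36 + (L * eta) ^+ 2 * (rho * B / n%:R))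
     + 10 * (enorm g ^+ 2 / 36 / r ^+ 2 + (L * eta) ^+ 2 * (rho * B / n%:R) / r ^+ 2)).
  have k1 : \sum_s N1 s ^+ 2 <= N * (rho / n%:R * (A * enorm g ^+ 2 + B)).
    exact: (@mean_sampling_error_sqr _ _ _ _ _ (fun i => grad1 (fs i) x y) g n2 bq
      (grad1_average n0 sfs x y) _ (variance1 x y) q0).
  have k2 : \sum_s N2 s ^+ 2 <= N * (rho / n%:R * (A * enorm w ^+ 2 + B)).
    exact: (@mean_sampling_error_sqr _ _ _ _ _ (fun i => grad2 (fs i) x y) w n2 bq
      (grad2_average n0 sfs x y) _ (variance2 x y) q0).
  pose S1 := \sum_s N1 s ^+ 2; pose S2 := \sum_s N2 s ^+ 2; pose eps := L * eta.
  have sumE : \sum_s E s = 25 / 16 * (25 / 16 * eps ^+ 2 * (N * enorm w ^+ 2 + S2)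
      + 10 * (eps / r) ^+ 2 * (N * enorm g ^+ 2 + S1)).
    rewrite /E -mulr_sumr big_split/=; congr (_ * (_ + _));
      by rewrite -mulr_sumr big_split/= sumr_const -[_ ^+ 2 *+ _]mulr_natl.
  rewrite /H mulrC ler_pdivrMr// sumE {sumE}.
  have total := mean_square_budget (ltW Npos).
  have h2 := le_trans (ler_wpM2l (sqr_ge0 eps) (lerD (lexx _) k2))
    (total _ (sqr_ge0 (enorm w))).
  have h1 := le_trans (ler_wpM2l (sqr_ge0 eps) (lerD (lexx _) k1))
    (total _ (sqr_ge0 (enorm g))).
  have r2 : 0 <= r^-1 ^+ 2 by exact: sqr_ge0.
  have := ler_wpM2l r2 h1; move: h2; rewrite -/S1 -/S2 -!exprVn /=.
  by move: S1 S2 (enorm w ^+ 2) (enorm g ^+ 2) N => S1 S2 w2 g2 m; lra.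
have gF : enorm g ^+ 2 <= 2 * (enorm F ^+ 2 + enorm (F - g) ^+ 2).
  by have := enorm_sqrD F (g - F); rewrite addrC subrK (enorm_distC g).
(* [|F - g| ^ 2 <= 2 L (2 + kappa2) gap], and PL bounds the gap by [w]. *)
have pw : enorm (F - g) ^+ 2 <= 3 * kappa2 ^+ 2 * enorm w ^+ 2.
  apply: le_trans (grad_gap_le L0 sf mu20 argmaxf pl2 x y) _.
  have := pl2 x y; rewrite -/w; set G := Phi x - _ => h.
  have c0 : 0 <= kappa2 * (2 + kappa2).
    by have := kappa2_ge1; move: kappa2 => k k1; rewrite mulr_ge0; lra.
  apply: le_trans (_ : kappa2 * (2 + kappa2) * enorm w ^+ 2 <= _).
    have -> : 2 * (L * (2 + kappa2)) * G = kappa2 * (2 + kappa2) * (2 * mu2 * G).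
      by field; rewrite gt_eqF.
    exact: ler_wpM2l.
  rewrite ler_wpM2r ?sqr_ge0//.
  have := (kappa2_ge1, kappa2_sqr) => -[]; lra.
have noise0 : 0 <= (L * eta) ^+ 2 * (rho * B / n%:R).
  by rewrite mulr_ge0 ?sqr_ge0// divr_ge0// mulr_ge0 ?rho_ge0.
have := descent_budget kappa2_ge1 r_ge eta0 (sqr_ge0 (enorm F)) (sqr_ge0 (enorm w))
  noise0 gF pw Hle.
have := potential_le_gradients x y; rewrite -/F -/w => h1 h2.
apply: le_trans (ler_sum _ (fun s _ => one s)) _.
rewrite (eq_bigr (fun s => V (x, y)
    + (eta / r / 2 * (- (49 / 20) * enorm F ^+ 2 + 9 / 2 * enorm (F - g) ^+ 2)
    + eta / 2 * (- (3 / 2) * enorm w ^+ 2))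
    + (eta / r / 2 * 16 + eta / 2 * (5 / 2)) * E s));
  last by move=> s _; ring.
rewrite big_split/= sumr_const -mulr_sumr -[_ *+ _]mulr_natl.
have -> : \sum_s E s = N * H by rewrite /H mulrA divff ?mul1r// gt_eqF.
rewrite [leLHS](_ : _ = N * (V (x, y)
    + (eta / r / 2 * (- (49 / 20) * enorm F ^+ 2 + 9 / 2 * enorm (F - g) ^+ 2)
    + eta / 2 * (- (3 / 2) * enorm w ^+ 2)) +
    (eta / r / 2 * 16 + eta / 2 * (5 / 2)) * H)); last by ring.
rewrite ler_wpM2l ?(ltW Npos)//; lra.
Qed.

End EpochDescent.

(** * Recursion over the epochs *)

Lemma sum_tuple_cons (V : nmodType) (T : finType) (K : nat) (F : K.+1.-tuple T -> V) :
  \sum_(ss : K.+1.-tuple T) F ss =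
  \sum_(s : T) \sum_(ss : K.-tuple T) F [tuple of s :: ss].
Proof.
rewrite pair_big (reindex (fun p : T * K.-tuple T => [tuple of p.1 :: p.2]))//=.
exists (fun ss => (thead ss, behead_tuple ss)) => [[s ss] _|ss _] /=.
  by congr pair; apply: val_inj.
by apply: val_inj => /=; rewrite [in RHS](tuple_eta ss).
Qed.

(** A uniform tuple of permutations is a uniform permutation followed by an
    independent uniform tuple. The additive error is written [D * (1 - a)], so that
    [D] is the fixed point of the recursion [e -> a e + D (1 - a)]. *)
Lemma expect_contraction (R : realType) (n : nat) (Z : Type)
    (V : Z -> R) (step : Z -> 'S_n -> Z) (a D : R) (K : nat) (z : Z) : 0 <= a ->
  (forall z, \sum_(s : 'S_n) V (step z s)
             <= #|{: 'S_n}|%:R * (a * V z + D * (1 - a))) ->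
  expect_perms (fun ss : K.-tuple 'S_n => V (foldl step z ss))
    <= a ^+ K * V z + D * (1 - a ^+ K).
Proof.
move=> a0 contr; rewrite /expect_perms ler_pdivrMr; last first.
  by rewrite ltr0n; apply/card_gt0P; exists [tuple of nseq K 1%g].
elim: K z => [|K IH] z.
  rewrite expr0 mul1r subrr mulr0 addr0 card_tuple expn0 mulr1.
  rewrite (eq_bigr (fun=> V z)) => [|ss _]; last by rewrite tuple0.
  by rewrite sumr_const card_tuple expn0.
rewrite sum_tuple_cons.
apply: le_trans (ler_sum _ (fun s _ => IH (step z s))) _.
rewrite -mulr_suml !card_tuple expnS natrM mulrA ler_wpM2r// big_split/= -mulr_sumr.
rewrite sumr_const -[_ *+ _]mulr_natl.
have := ler_wpM2l (exprn_ge0 K a0) (contr z).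
rewrite exprS; lra.
Qed.

Theorem theorem5 (R : realType) :
  exists c C p : R, [/\ 0 < c, 0 < C, 0 < p &
  forall (dx dy n K b : nat) (fs : 'I_n -> 'rV[R]_(dx + dy) -> R)
    (L A B mu1 mu2 r : R) (z0 : 'rV[R]_dx * 'rV[R]_dy),
  let f := average fs in
  let Phi := primal f in
  let Phistar := primal_min f in
  let V := potential 4 f in
  let kappa1 := L / mu1 in
  let kappa2 := L / mu2 in
  let rho := (n%:R - b%:R) / (n%:R - 1) in
  let S := Num.sqrt (1 + rho * (A / n%:R)) in
  let Lambda := (V z0 * mu1 * n%:R * K%:R ^+ 2) /
                (8 * c ^+ 3 * kappa1 ^+ 2 * r ^+ 3 * rho * B) in
  (* max {1, log Lambda}: since ln 0 = 0 in the library, this is 1 for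
     Lambda = 0, in agreement with the convention log 0 = -oo *)
  let M := Num.max 1 (ln Lambda) in
  let beta1 := 1 / (6 * L * n%:R * S) in
  let beta2 := 2 * r / (mu1 * n%:R * K%:R) * M in
  let beta := b%:R *
    (if (n%:R - b%:R) * B == 0 then beta1 else Num.min beta1 beta2) in
  let alpha := beta / r in
  (2 <= n)%N -> (1 <= K)%N -> (0 < b)%N -> (b %| n)%N ->
  (* (a) *)
  0 < L -> (forall i, smooth L (fs i)) ->
  (* (b) *)
  0 <= A -> 0 <= B ->
  (forall x y, n%:R^-1 * \sum_(i < n)
       enorm (grad1 (fs i) x y - grad1 f x y) ^+ 2
     <= A * enorm (grad1 f x y) ^+ 2 + B) ->
  (forall x y, n%:R^-1 * \sum_(i < n)
       enorm (grad2 (fs i) x y - grad2 f x y) ^+ 2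
     <= A * enorm (grad2 f x y) ^+ 2 + B) ->
  (* (c) *)
  (forall x, argmax f x !=set0 /\ closed (argmax f x)) ->
  has_lbound (range Phi) ->
  (* (d) *)
  0 < mu2 ->
  (forall x y, 2 * mu2 * (Phi x - f (row_mx x y))
     <= enorm (grad2 f x y) ^+ 2) ->
  (* (e) *)
  (exists xstar, forall x, Phi xstar <= Phi x) ->
  0 < mu1 ->
  (forall x, 2 * mu1 * (Phi x - Phistar) <= enorm (grad Phi x) ^+ 2) ->
  (* If f does not depend on y (resp. Phi is constant), then (d) (resp. (e))
     holds for every mu2 > 0 (resp. mu1 > 0) and L / mu2 (resp. L / mu1) is not
     a condition number. In these two degenerate cases only, the constants are
     required to be at most L. *)
  ((forall x y, f (row_mx x y) = Phi x) -> mu2 <= L) ->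
  ((forall x, Phi x = Phistar) -> mu1 <= L) ->
  14 * kappa2 ^+ 2 <= r ->
  forall v : sgda_variant,
    expect_perms (fun ss : K.-tuple 'S_n => V (sgda_rr v fs b alpha beta z0 ss))
    <= C * V z0 * expR (- (K%:R / (12 * kappa1 * r * S)))
       + C * (kappa1 ^+ 2 * r ^+ 3 * B / (mu1 * n%:R * K%:R ^+ 2))
           * M `^ p * rho].
Proof.
(* The noise floor is quadratic in the step size, hence [p = 2]. It contributes
   40 to [C], and the 8 in the denominator of Lambda contributes the rest. *)
exists 1, 48, 2; split=> // dx dy n K b fs L A B mu1 mu2 r z0.
move=> f Phi Phistar V kappa1 kappa2 rho S Lambda M beta1 beta2 beta alpha.
move=> n2 K1 b0 bn L0 sfs A0 B0 var1 var2 amax lb mu20 pl2 _ mu10 pl1 deg2 deg1 r_ge v.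
have argmaxf x : argmax f x !=set0 by have [] := amax x.
have n0 : (0 < n)%N by exact: ltn_trans n2.
have sf : smooth L f by exact: smooth_average.
have mu2L : mu2 <= L by exact: (mu2_le L0 sf argmaxf pl2 deg2).
have mu1L : mu1 <= L * (1 + kappa2).
  exact: (mu1_le L0 sf mu20 argmaxf pl2 lb pl1 deg1).
have nR : 0 < n%:R :> R by rewrite ltr0n.
have KR : 0 < K%:R :> R by rewrite ltr0n.
have bR : 0 < b%:R :> R by rewrite ltr0n.
have n1R : 0 < n%:R - 1 :> R by rewrite subr_gt0 ltr1n.
pose q := (n %/ b)%N; have bq : (b * q)%N = n by rewrite mulnC divnK.
have q0 : (0 < q)%N by rewrite divn_gt0// dvdn_leq.
have rho0 : 0 <= rho by rewrite divr_ge0 ?(ltW n1R)// subr_ge0 ler_nat dvdn_leq.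
have k21 : 1 <= kappa2 by rewrite ler_pdivlMr// mul1r.
have k2sqr : kappa2 <= kappa2 ^+ 2 by rewrite expr2 ler_peMl// (le_trans ler01).
have r14 : 14 <= r by lra.
have r0 : 0 < r by lra.
have arg1 : 1 <= 1 + rho * (A / n%:R).
  by rewrite lerDl mulr_ge0// divr_ge0// ltW.
have S2 : S ^+ 2 = 1 + rho * (A / n%:R) by rewrite sqr_sqrtr// (le_trans ler01).
have S1 : 1 <= S by rewrite -sqrtr1 ler_wsqrtr.
have S0 : 0 < S by exact: lt_le_trans S1.
have M1 : 1 <= M by rewrite le_max lexx.
(* The length of an epoch in [y]; the one in [x] is [eta / r]. *)
pose eta := beta * q%:R.
have nRE : n%:R = b%:R * q%:R :> R by rewrite -bq natrM.
have b1 : 0 < beta1 by rewrite divr_gt0// !mulr_gt0.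
have M0 : 0 < M by exact: lt_le_trans M1.
have b2 : 0 < beta2.
  by rewrite mulr_gt0// divr_gt0// !mulr_gt0.
pose m := if (n%:R - b%:R) * B == 0 then beta1 else Num.min beta1 beta2.
have m0 : 0 < m by rewrite /m; case: ifP => // _; rewrite lt_min b1.
have mb1 : m <= beta1 by rewrite /m; case: ifP => // _; rewrite ge_min lexx.
have beta0 : 0 < beta by rewrite mulr_gt0.
have etaE : eta = n%:R * m by rewrite /eta /beta -/m nRE; ring.
have eta0 : 0 < eta by rewrite etaE mulr_gt0.
have LetaS : L * eta * S <= 6^-1.
  have -> : 6^-1 = L * (n%:R * beta1) * S.
    by rewrite /beta1; field; rewrite !gt_eqF.
  by rewrite etaE ler_wpM2r ?(ltW S0)// ler_wpM2l ?(ltW L0)// ler_wpM2l// ltW.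
have step : (L * eta) ^+ 2 * (1 + rho * (A / n%:R)) <= 36^-1.
  rewrite -S2 -exprMn; apply: le_trans (_ : 6^-1 ^+ 2 <= _); last lra.
  have LeS0 : 0 <= L * eta * S.
    exact: mulr_ge0 (mulr_ge0 (ltW L0) (ltW eta0)) (ltW S0).
  by rewrite lerXn2r ?nnegrE.
(* The contraction rate per epoch, and the noise floor. *)
pose x := eta * mu1 / (2 * r).
have x0 : 0 < x by rewrite divr_gt0 ?(mulr_gt0 eta0)// mulr_gt0.
have x1 : x <= 1.
  rewrite ler_pdivrMr ?mulr_gt0// mul1r.
  have h1 : L * eta <= 6^-1.
    by apply: le_trans LetaS; rewrite ler_peMr// (mulr_ge0 (ltW L0) (ltW eta0)).
  have := ler_wpM2l (ltW eta0) mu1L.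
  have := ler_wpM2r (le_trans ler01 k21) h1.
  lra.
pose D := 10 * r * (L * eta) ^+ 2 * (rho * B / n%:R) / mu1.
have D0 : 0 <= D.
  rewrite /D divr_ge0 ?(ltW mu10)// mulr_ge0//; last first.
    by rewrite divr_ge0 ?(ltW nR)// mulr_ge0.
  by rewrite mulr_ge0 ?sqr_ge0// mulr_ge0// ltW.
have := @expect_contraction R n _ V (sgda_epoch v fs b alpha beta) (1 - x) D K z0.
rewrite subr_ge0 => /(_ x1) contr.
have {}contr : expect_perms
    (fun ss : K.-tuple 'S_n => V (sgda_rr v fs b alpha beta z0 ss))
    <= (1 - x) ^+ K * V z0 + D * (1 - (1 - x) ^+ K).
  apply: contr => z.
  have := epoch_descent v n2 bq b0 q0 L0 sfs A0 B0 var1 var2 argmaxf mu20 pl2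
    pl1 mu2L mu1L r_ge beta0 (erefl alpha) step z.
  rewrite -/eta -/x => /le_trans; apply.
  rewrite ler_wpM2l// lerD2l opprB addrCA subrr addr0 /D /x.
  by rewrite -/rho le_eqVlt; apply/orP; left; apply/eqP; field; rewrite !gt_eqF.
apply: le_trans contr _.
have a0 : 0 <= (1 - x) ^+ K by rewrite exprn_ge0 ?subr_ge0.
have aexp : (1 - x) ^+ K <= expR (- (x * K%:R)).
  rewrite (mulrC x) -[- (_ * x)]mulrN expRM_natl lerXn2r ?nnegrE ?subr_ge0 ?expR_ge0//.
  exact: expR_ge1Dx.
have V0 : 0 <= V z0.
  rewrite /V /potential addr_ge0 ?mulr_ge0 ?subr_ge0//; first exact: primal_min_le.
  exact: primal_ge.
apply: le_trans (_ : V z0 * expR (- (x * K%:R)) + D <= _).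
  rewrite mulrC lerD ?ler_wpM2l//.
  by rewrite ler_piMr// gerBl.
set E1 := expR (- (K%:R / _)).
(* The first argument of the minimum turns the contraction into the claimed
   exponential rate, the second one into [expR (- M)]. *)
have exp1 : m = beta1 -> expR (- (x * K%:R)) = E1.
  move=> mE; rewrite /E1 /x etaE mE /beta1 /kappa1; congr (expR (- _)).
  by field; rewrite !gt_eqF.
rewrite powR_mulrn ?(le_trans ler01)//.
set Q := kappa1 ^+ 2 * r ^+ 3 * B / (mu1 * n%:R * K%:R ^+ 2).
have E10 : 0 <= E1 by exact: expR_ge0.
have Q0 : 0 <= Q.
  rewrite divr_ge0//; last by rewrite !mulr_ge0// ?sqr_ge0 ?ltW.
  by rewrite mulr_ge0// mulr_ge0 ?sqr_ge0 ?exprn_ge0 ?(ltW r0).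
have QM0 : 0 <= Q * M ^+ 2 * rho by exact: mulr_ge0 (mulr_ge0 Q0 (sqr_ge0 M)) rho0.
have VE0 : 0 <= V z0 * E1 by rewrite mulr_ge0.
have [nb0|nb0] := eqVneq ((n%:R - b%:R) * B) 0.
  have mE : m = beta1 by rewrite /m nb0 eqxx.
  have rB0 : rho * B = 0 by rewrite /rho mulrAC nb0 mul0r.
  rewrite (exp1 mE) /D rB0 mul0r mulr0 mul0r addr0.
  lra.
have B1 : 0 < B.
  rewrite lt_neqAle B0 andbT eq_sym; apply: contraNneq nb0 => ->.
  by rewrite mulr0.
have rho1 : 0 < rho.
  rewrite lt_neqAle rho0 andbT eq_sym; apply: contraNneq nb0 => h.
  have -> : n%:R - b%:R = rho * (n%:R - 1) :> R by rewrite divfK// gt_eqF.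
  by rewrite h !mul0r.
have mE : m = Num.min beta1 beta2 by rewrite /m (negbTE nb0).
have mb2 : m <= beta2 by rewrite mE ge_min lexx orbT.
have Dle : D <= 40 * (Q * M ^+ 2 * rho).
  have -> : 40 * (Q * M ^+ 2 * rho) =
      10 * r * (L * (n%:R * beta2)) ^+ 2 * (rho * B / n%:R) / mu1.
    by rewrite /Q /kappa1 /beta2; field; rewrite !gt_eqF.
  rewrite /D ler_wpM2r ?invr_ge0 ?(ltW mu10)// ler_wpM2r//.
    by rewrite divr_ge0 ?(ltW nR)// mulr_ge0.
  rewrite ler_wpM2l ?mulr_ge0 ?(ltW r0)//.
  have h : L * eta <= L * (n%:R * beta2).
    by rewrite ler_wpM2l ?(ltW L0)// etaE ler_wpM2l// ltW.
  have Le0 : 0 <= L * eta by exact: mulr_ge0 (ltW L0) (ltW eta0).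
  by rewrite lerXn2r ?nnegrE// (le_trans Le0).
have expM : V z0 * expR (- M) <= 8 * (Q * M ^+ 2 * rho).
  have [->|Vneq] := eqVneq (V z0) 0.
    by rewrite mul0r mulr_ge0.
  have Vpos : 0 < V z0 by rewrite lt_neqAle eq_sym Vneq.
  have kap0 : 0 < kappa1 by rewrite divr_gt0.
  have Lam0 : 0 < Lambda.
    rewrite /Lambda expr1n; apply: divr_gt0.
      by rewrite mulr_gt0 ?exprn_gt0// mulr_gt0// mulr_gt0.
    by rewrite mulr1 mulr_gt0// mulr_gt0// mulr_gt0 ?exprn_gt0// mulr_gt0 ?exprn_gt0.
  have : expR (- M) <= Lambda^-1.
    rewrite expRN lef_pV2 ?posrE ?expR_gt0// -[leLHS]lnK ?posrE//.
    by rewrite ler_expR le_max lexx orbT.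
  move/(ler_wpM2l (ltW Vpos))/le_trans; apply.
  have -> : V z0 / Lambda = 8 * (Q * rho).
    by rewrite /Lambda /Q; field; rewrite !gt_eqF// ?exprn_gt0.
  rewrite ler_wpM2l// (mulrAC Q) ler_peMr ?(mulr_ge0 Q0 rho0)//.
  by rewrite exprn_ege1.
have expb : expR (- (x * K%:R)) <= E1 + expR (- M).
  have [le12|/ltW le21] := leP beta1 beta2.
    by rewrite exp1 ?mE ?min_l// lerDl expR_ge0.
  rewrite (_ : x * K%:R = M) ?lerDr//.
  rewrite /x etaE mE min_r// /beta2; field; rewrite !gt_eqF//.
have := ler_wpM2l V0 expb; lra.
Qed.
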